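(* Let $n\ge 1$. For $P,Q\in\mathcal{O}_{2n}$ define $$\{P,Q\}=\lim_{l\to\infty}\Theta_l^{-1}\bigl(\{\Theta_l(P),\Theta_l(Q)\}_{q_l}\bigr).$$ Then this limit exists (coefficientwise) for all $P,Q$, and the bracket $\{\ ,\ \}$ on $\mathcal{O}_{2n}$ so defined is equal to the standard Poisson bracket $\{\ ,\ \}_{\mathcal{O}_{2n}}$.
   Context: Let $R=\mathbb{C}[t,t^{-1}]$. The quantized Weyl algebra is $A^{(t)}_n=R\langle x_1,\dots,x_n,\partial_1,\dots,\partial_n\rangle/I_t$, where $I_t$ is the two-sided ideal generated by $\partial_i x_j-t^{\delta_{ij}}x_j\partial_i-\delta_{ij}$, $x_ix_j-x_jx_i$ and $\partial_i\partial_j-\partial_j\partial_i$ for $1\le i,j\le n$. For $q\in\mathbb{C}^*$, $A^q_n=A^{(t)}_n/(t-q)$ and $\pi_q:A^{(t)}_n\to A^q_n$ is the quotient map; we also write $\pi_q$ for evaluation at $t=q$ of rational functions in $t$ regular at $q$. Quantum integers: $[m]_t=(1-t^m)/(1-t)$, $[m]_t!=[m]_t[m-1]_t\cdots[1]_t$. For $q$ a primitive $l$-th root of unity, $l>1$, the center of $A^q_n$ is the polynomial ring $Z^q_n=\mathbb{C}[x_1^l,\dots,x_n^l,\partial_1^l,\dots,\partial_n^l]$, with Poisson bracket $$\{P,Q\}_q=\lambda_q\cdot\pi_q\Bigl(\tfrac{1}{t-q}[\widetilde P,\widetilde Q]\Bigr),\qquad \lambda_q=\pi_q\Bigl(\tfrac{t-q}{[l]_t!}\Bigr),$$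 where $\widetilde P,\widetilde Q\in A^{(t)}_n$ are any lifts of $P,Q$ along $\pi_q$ and $[\widetilde P,\widetilde Q]=\widetilde P\widetilde Q-\widetilde Q\widetilde P$ (divisible by $t-q$); this is independent of the lifts. Let $q_l=\exp(2\pi i/l)$, with $i$ the imaginary unit. Let $\mathcal{O}_{2n}=\mathbb{C}[r_1,\dots,r_n,s_1,\dots,s_n]$ with standard Poisson bracket $\{\phi,\psi\}_{\mathcal{O}_{2n}}=\sum_{i=1}^n\left(\frac{\partial\phi}{\partial r_i}\frac{\partial\psi}{\partial s_i}-\frac{\partial\psi}{\partial r_i}\frac{\partial\phi}{\partial s_i}\right)$. Let $\Theta_l:\mathcal{O}_{2n}\to Z^{q_l}_n$ be the algebra isomorphism with $\Theta_l(r_i)=\partial_i^l$, $\Theta_l(s_i)=x_i^l$. Limits of polynomials are taken coefficientwise in the analytic topology of $\mathbb{C}$. *)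

(* Defs.v *)
From HB Require Import structures.
From mathcomp Require Import all_boot all_order all_algebra.
From mathcomp Require Import fraction generic_quotient ring_quotient.
From mathcomp Require Import all_classical all_reals all_analysis.
From mathcomp Require Import complex.
From mathcomp Require Import -(notations) monalg.
From mathcomp Require Import -(notations) mpoly.

Set Implicit Arguments.
Unset Strict Implicit.
Unset Printing Implicit Defensive.

Import Order.TTheory GRing.Theory Num.Theory.
Import numFieldNormedType.Exports.

Local Open Scope classical_set_scope.
Local Open Scope ring_scope.
Local Open Scope complex_scope.
Local Open Scope quotient_scope.

(** The quotient [A / (S)] of a ring by the two-sided ideal generated by [S].  It
    is a [pzRingType], so that [(S)] need not be shown to be proper. *)
Section TwoSidedQuotient.
Variables (A : pzRingType) (S : set A).

Definition two_sided_ideal (J : set A) : Prop :=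
  [/\ J 0, forall x y, J x -> J y -> J (x - y),
      forall a x, J x -> J (a * x) & forall a x, J x -> J (x * a)].

Definition ideal_gen : set A :=
  \bigcap_(J in [set J | two_sided_ideal J /\ S `<=` J]) J.

Lemma ideal_gen_ideal : two_sided_ideal ideal_gen.
Proof.
split=> [J [[J0 _ _ _] _]|x y Ix Iy J iJ|a x Ix J iJ|a x Ix J iJ].
- exact: J0.
- have [[_ JB _ _] _] := iJ; exact: JB (Ix _ iJ) (Iy _ iJ).
- have [[_ _ JM _] _] := iJ; exact: JM (Ix _ iJ).
- have [[_ _ _ JM] _] := iJ; exact: JM (Ix _ iJ).
Qed.

Definition in_ideal_gen : {pred A} := fun a => `[< ideal_gen a >].

Lemma in_ideal_genP a : reflect (ideal_gen a) (a \in in_ideal_gen).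
Proof. exact: asboolP. Qed.

Lemma in_ideal_gen_zmod : zmod_closed in_ideal_gen.
Proof.
have [I0 IB _ _] := ideal_gen_ideal.
split=> [|x y /in_ideal_genP Ix /in_ideal_genP Iy]; apply/in_ideal_genP => //.
exact: IB.
Qed.

HB.instance Definition _ :=
  GRing.isZmodClosed.Build A in_ideal_gen in_ideal_gen_zmod.

Definition quot_by := Quotient.quot in_ideal_gen.

HB.instance Definition _ := EqQuotient.on quot_by.
HB.instance Definition _ := GRing.Zmodule.on quot_by.

Definition quot_one : quot_by := lift_cst quot_by 1.
Definition quot_mul := lift_op2 quot_by *%R.

Canonical quot_pi_one_morph := PiConst quot_one.

Lemma quot_piE (x y : A) :
  (\pi_quot_by x == \pi_quot_by y) = (x - y \in in_ideal_gen).
Proof. by rewrite (Quotient.idealrBE in_ideal_gen). Qed.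

Lemma quot_pi_mul : {morph \pi_quot_by : x y / x * y >-> quot_mul x y}.
Proof.
have [_ _ Il Ir] := ideal_gen_ideal.
move=> x y; unlock quot_mul; apply/eqP; rewrite quot_piE.
set x' := repr _; set y' := repr _.
have xI : x - x' \in in_ideal_gen by rewrite -quot_piE reprK.
have yI : y - y' \in in_ideal_gen by rewrite -quot_piE reprK.
rewrite -[_ * _](addrNK (x * y')) -mulrBr -addrA -mulrBl rpredD //.
  by apply/in_ideal_genP; apply: Il; apply/in_ideal_genP.
by apply/in_ideal_genP; apply: Ir; apply/in_ideal_genP.
Qed.
Canonical quot_pi_mul_morph := PiMorph2 quot_pi_mul.

Lemma quot_mulA : associative quot_mul.
Proof. by move=> x y z; rewrite -[x]reprK -[y]reprK -[z]reprK !piE mulrA. Qed.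

Lemma quot_mul1 : left_id quot_one quot_mul.
Proof. by move=> x; rewrite -[x]reprK !piE mul1r. Qed.

Lemma quot_1mul : right_id quot_one quot_mul.
Proof. by move=> x; rewrite -[x]reprK !piE mulr1. Qed.

Lemma quot_mulDl : left_distributive quot_mul +%R.
Proof.
by move=> x y z; rewrite -[x]reprK -[y]reprK -[z]reprK !piE mulrDl.
Qed.

Lemma quot_mulDr : right_distributive quot_mul +%R.
Proof.
by move=> x y z; rewrite -[x]reprK -[y]reprK -[z]reprK !piE mulrDr.
Qed.

HB.instance Definition _ := GRing.Zmodule_isPzRing.Build quot_by
  quot_mulA quot_mul1 quot_1mul quot_mulDl quot_mulDr.

Definition quot_map (a : A) : quot_by := \pi_quot_by a.

Lemma quot_map_zmod : zmod_morphism quot_map.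
Proof. by move=> x y; rewrite /quot_map !piE. Qed.

Lemma quot_map_monoid : monoid_morphism quot_map.
Proof. by split=> [|x y]; rewrite /quot_map !piE. Qed.

HB.instance Definition _ :=
  GRing.isZmodMorphism.Build A quot_by quot_map quot_map_zmod.
HB.instance Definition _ :=
  GRing.isMonoidMorphism.Build A quot_by quot_map quot_map_monoid.

End TwoSidedQuotient.

Section LaurentPolynomials.
Variable K : fieldType.

Notation ratfun := {fraction {poly K}}.
Notation "p %:F" := (@FracField.tofrac {poly K} p).

Definition is_laurent : {pred ratfun} :=
  fun f => `[< exists (p : {poly K}) (k : nat), f = p%:F / ('X%:F) ^+ k >].

Lemma is_laurentP (f : ratfun) :
  reflect (exists (p : {poly K}) (k : nat), f = p%:F / ('X%:F) ^+ k)
          (f \in is_laurent).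
Proof. exact: asboolP. Qed.

Lemma ratX_neq0 : 'X%:F != 0 :> ratfun.
Proof. by rewrite tofrac_eq0 polyX_eq0. Qed.

Lemma is_laurent_subring : subring_closed is_laurent.
Proof.
split=> [|f g|f g].
- by apply/is_laurentP; exists 1, 0%N; rewrite expr0 divr1 tofrac1.
- move=> /is_laurentP[p [k ->]] /is_laurentP[r [m ->]]; apply/is_laurentP.
  exists (p * 'X^m - r * 'X^k), (k + m)%N.
  have X0 j : 'X%:F ^+ j != 0 :> ratfun by rewrite expf_neq0 ?ratX_neq0.
  rewrite tofracB !tofracM !tofracXn exprD mulrBl; congr (_ - _).
    by rewrite -mulf_div divff ?X0 ?mulr1.
  by rewrite ['X%:F ^+ k * _ in RHS]mulrC -mulf_div divff ?X0 ?mulr1.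
- move=> /is_laurentP[p [k ->]] /is_laurentP[r [m ->]]; apply/is_laurentP.
  by exists (p * r), (k + m)%N; rewrite exprD tofracM mulf_div.
Qed.

HB.instance Definition _ :=
  GRing.isSubringClosed.Build ratfun is_laurent is_laurent_subring.

(** The ring [K[t, t^-1]], as a subring of the field [K(t)]; the indeterminate
    ['X] of [{poly K}] plays the role of [t], and [K] is the complex field in
    the application. *)
Record laurent := Laurent {
  laurent_val : ratfun;
  laurent_valP : laurent_val \in is_laurent }.

HB.instance Definition _ := [isSub for laurent_val].
HB.instance Definition _ := [Choice of laurent by <:].
HB.instance Definition _ := [SubChoice_isSubComNzRing of laurent by <:].

Lemma poly_is_laurent (p : {poly K}) : p%:F \in is_laurent.
Proof. by apply/is_laurentP; exists p, 0%N; rewrite expr0 divr1. Qed.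

Definition laurent_poly (p : {poly K}) : laurent := Laurent (poly_is_laurent p).

(** Quantum integers and factorials, as elements of [K(t)]. *)
Definition qint (m : nat) : ratfun := (1 - 'X%:F ^+ m) / (1 - 'X%:F).

Definition qfact (m : nat) : ratfun := \prod_(1 <= k < m.+1) qint k.

(** Evaluation at [q] of a rational function that is regular at [q]; the value
    is [0] if the function has a pole there. *)
Definition rat_eval (q : K) (f : ratfun) : K :=
  xget 0 [set v | exists p d : {poly K},
            [/\ d.[q] != 0, f = p%:F / d%:F & v = p.[q] / d.[q]]].

Definition lambda (l : nat) (q : K) : K :=
  rat_eval q (('X - q%:P)%:F / qfact l).

End LaurentPolynomials.

Section QuantizedWeylAlgebra.
Variables (K : fieldType) (n : nat).

(** The free algebra on [x_i] ([inl i]) and [d_i] ([inr i]) over [K[t, t^-1]]: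
    the algebra of the free monoid on these letters. *)
Definition free_alg : nzRingType :=
  monalg.malg (monalg.fmonom ('I_n + 'I_n)%type) (laurent K).

Definition free_const (f : laurent K) : free_alg :=
  @monalg.mkmalgU _ (laurent K) (monalg.fmone _) f.
Definition free_gen (g : 'I_n + 'I_n) : free_alg :=
  @monalg.mkmalgU _ (laurent K) (monalg.fmu g) 1.
Definition free_x (i : 'I_n) : free_alg := free_gen (inl i).
Definition free_d (i : 'I_n) : free_alg := free_gen (inr i).

Definition weyl_relations : set free_alg :=
  [set a | exists i j : 'I_n,
     [\/ a = free_d i * free_x j
              - free_const (laurent_poly 'X) ^+ (i == j) * (free_x j * free_d i)
              - (i == j)%:R,
         a = free_x i * free_x j - free_x j * free_x i
       | a = free_d i * free_d j - free_d j * free_d i]].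

Definition qweyl : pzRingType := quot_by weyl_relations.

Definition qweyl_const (f : laurent K) : qweyl :=
  quot_map weyl_relations (free_const f).
Definition qweyl_x (i : 'I_n) : qweyl := quot_map weyl_relations (free_x i).
Definition qweyl_d (i : 'I_n) : qweyl := quot_map weyl_relations (free_d i).

Variable q : K.

Definition t_minus_q : qweyl := qweyl_const (laurent_poly ('X - q%:P)).

Definition qweyl_at : pzRingType := quot_by [set t_minus_q].

Definition pi_q : qweyl -> qweyl_at := quot_map [set t_minus_q].

Definition at_const (c : K) : qweyl_at := pi_q (qweyl_const (laurent_poly c%:P)).
Definition at_x (i : 'I_n) : qweyl_at := pi_q (qweyl_x i).
Definition at_d (i : 'I_n) : qweyl_at := pi_q (qweyl_d i).

Definition center : set qweyl_at :=
  [set z | forall a : qweyl_at, z * a = a * z].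

(** [V] is a value of the bracket of the central elements [P] and [Q]: it is
    obtained from some lifts [Pt], [Qt] of [P], [Q] and some quotient [B] of
    their commutator by [t - q].  When [q] is a primitive [l]-th root of unity,
    [1 < l], there is exactly one such [V] for all central [P] and [Q]. *)
Definition is_poisson_q (l : nat) (P Q V : qweyl_at) : Prop :=
  [/\ center P, center Q &
    exists Pt Qt B : qweyl,
      [/\ pi_q Pt = P, pi_q Qt = Q, t_minus_q * B = Pt * Qt - Qt * Pt
        & V = at_const (lambda l q) * pi_q B]].

Definition poisson_q (l : nat) (P Q : qweyl_at) : qweyl_at :=
  xget 0 [set V | is_poisson_q l P Q V].

(** [O_{2n}] is [K[r_1, ..., r_n, s_1, ..., s_n]]: the variable [r_i] has index
    [lshift n i] and [s_i] has index [rshift n i]. *)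
Definition poisson_std (f g : mpoly (n + n) K) : mpoly (n + n) K :=
  \sum_(i < n) (mderiv (lshift n i) f * mderiv (rshift n i) g
                - mderiv (lshift n i) g * mderiv (rshift n i) f).

(** The algebra map with [r_i |-> d_i ^ l] and [s_i |-> x_i ^ l], written out on
    monomials.  For [q] a primitive [l]-th root of unity, it is an isomorphism
    onto [center], and [Theta_inv] is its inverse there. *)
Definition Theta (l : nat) (f : mpoly (n + n) K) : qweyl_at :=
  \sum_(m <- msupp f)
    at_const (mcoeff m f)
    * (\prod_(i < n) (at_d i ^+ l) ^+ m (lshift n i))
    * (\prod_(i < n) (at_x i ^+ l) ^+ m (rshift n i)).

Definition Theta_inv (l : nat) (z : qweyl_at) : mpoly (n + n) K :=
  xget 0 [set f | Theta l f = z].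

End QuantizedWeylAlgebra.

(** [exp (2 pi i / l)] *)
Definition q_root (R : realType) (l : nat) : R[i] :=
  cos (2 * pi / l%:R) +i* sin (2 * pi / l%:R).

(** The bracket on [O_{2n}] transported from the center of [qweyl_at] at
    [exp (2 pi i / l)]; it is meaningful for [1 < l]. *)
Definition poisson_l (R : realType) (n l : nat) (P Q : mpoly (n + n) R[i]) :
    mpoly (n + n) R[i] :=
  let q := q_root R l in
  Theta_inv l (poisson_q l (Theta q l P) (Theta q l Q)).

(** Coefficientwise convergence; the cast to [numFieldType] selects the topology
    of [R[i]] given by the modulus. *)
Definition mpoly_cvg (R : realType) (N : nat) (u : nat -> mpoly N R[i])
    (f : mpoly N R[i]) : Prop :=
  forall m : multinom N,
    (fun l => mcoeff m (u l) : (R[i] : numFieldType)) @ \oo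
      --> (mcoeff m f : (R[i] : numFieldType)).

(* Main.v *)
Require Import Defs.
From HB Require Import structures.
From mathcomp Require Import all_boot all_order all_algebra.
From mathcomp Require Import all_classical all_reals all_analysis.
From mathcomp Require Import complex.
From mathcomp Require Import ring lra.
From mathcomp Require Import -(notations) finmap.
From mathcomp Require Import ssrcomplements.
From mathcomp Require Import -(notations) monalg.
From mathcomp Require Import -(notations) mpoly.

(** For [l > 1] and [q] a primitive [l]-th root of unity, the bracket transported
    to [O_{2n}] is exactly
      [{P, Q}_l = \sum_i (1 + c_l r_i s_i) (P_{r_i} Q_{s_i} - Q_{r_i} P_{s_i})]
    with [c_l = - (1 - q) ^ l], and [c_l] tends to [0] for [q = exp (2 pi i / l)].

    The bracket is an antisymmetric biderivation, so the formula only has to be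
    checked on generators, where the one nontrivial case is [d^l x^l - x^l d^l].
    Expand [d^l x^l] into ordered monomials [x^(l-k) d^(l-k)]: for [0 < k < l] the
    coefficient is a multiple of the Gaussian binomial [(l choose k)_t] times
    [[l]_t], hence vanishes to second order at [q] and contributes nothing.  The
    terms [k = l] and [k = 0] have coefficients [[l]_t!] and [t^(l^2) - 1]; after
    division by [t - q], evaluation at [q] and multiplication by [lambda_q] they
    become [1] and [c_l].

    That the bracket and [Theta^-1] are well defined rests on a PBW theorem: the
    ordered monomials [x^a d^b] span by straightening, and are independent because
    the relations act on formal series as left multiplication should. *)

Set Implicit Arguments.
Unset Strict Implicit.
Unset Printing Implicit Defensive.

Import Order.TTheory GRing.Theory Num.Theory.
Import numFieldNormedType.Exports.

Local Open Scope classical_set_scope.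
Local Open Scope ring_scope.
Local Open Scope complex_scope.

(** * PBW theorem for the quantized Weyl algebra *)

Section LinearExtension.
Variables (N : nat) (R : nzRingType) (Z : zmodType).
Variable F : multinom N -> {additive R -> Z}.

(** Additive maps [F m] stand in for scalar multiplication, since the targets below are bare rings
    whose scalars enter through a ring morphism. *)
Definition lin_ext (f : mpoly N R) : Z := \sum_(m <- msupp f) F m (mcoeff m f).

Lemma lin_ext_zmod : zmod_morphism lin_ext.
Proof.
(* The supports of [f], [g] and [f - g] differ, so the three sums are first put over one finite set
   of monomials of bounded degree. *)
have E f k : (msize f <= k)%N ->
    lin_ext f = \sum_(m : bmultinom N k) F m (mcoeff (m : bmultinom N k) f).
  move=> le_fk; pose I : subFinType _ := bmultinom N k.
  rewrite /lin_ext (big_mksub I) ?msupp_uniq //=; first last.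
    by move=> x /msize_mdeg_lt /leq_trans; apply.
  rewrite big_rmcond //= => j /memN_msupp_eq0 ->; exact: raddf0.
move=> f g; set k := (msize f + msize g + msize (f - g))%N.
rewrite !(E _ k) -?sumrB.
  by apply: eq_bigr => m _; rewrite mcoeffB raddfB.
all: by rewrite /k ?leq_addl // -addnA ?leq_addr // addnCA leq_addr.
Qed.

HB.instance Definition _ :=
  GRing.isZmodMorphism.Build (mpoly N R) Z lin_ext lin_ext_zmod.

Lemma lin_extZX c m : lin_ext (c *: mpolyX R m) = F m c.
Proof.
have [->|c0] := eqVneq c 0; first by rewrite scale0r !raddf0.
by rewrite /lin_ext msuppMCX // big_seq1 mcoeffZ mcoeffX eqxx mulr1.
Qed.

End LinearExtension.

Lemma comm_prod_exprD (S : pzRingType) (I : Type) (r : seq I) (h : I -> S)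
    (a b : I -> nat) : (forall i j, GRing.comm (h i) (h j)) ->
  \prod_(i <- r) h i ^+ (a i + b i)%N
    = (\prod_(i <- r) h i ^+ a i) * (\prod_(i <- r) h i ^+ b i).
Proof.
move=> comm_h; elim: r => [|i r IH]; first by rewrite !big_nil mulr1.
rewrite !big_cons IH exprD -!mulrA; congr (_ * _); rewrite !mulrA; congr (_ * _).
apply: commr_prod => j _; apply: commrX; apply: commr_sym; apply: commrX; exact: comm_h.
Qed.

Lemma prod_expr_delta (S : pzRingType) n (h : 'I_n -> S) (j : 'I_n) :
  \prod_(i < n) h i ^+ (j == i) = h j.
Proof.
have E (r : seq 'I_n) : uniq r ->
    \prod_(i <- r) h i ^+ (j == i) = if j \in r then h j else 1.
  elim: r => [|i r IH]; first by rewrite big_nil.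
  rewrite big_cons /= in_cons => /andP[ir /IH ->].
  case: eqVneq ir => [->|_ _] /=; last by rewrite mul1r.
  by move/negbTE=> ->; rewrite expr1 mulr1.
by rewrite E ?mem_index_enum // index_enum_uniq.
Qed.

(** Over an abstract ring, because in the free algebra failing unifications of
    ring operations unfold its convolution product. *)
Section AbstractAction.
Variables (A : pzRingType) (T : Type) (C : comPzRingType).
Variable act : A -> (T -> C) -> T -> C.
Hypothesis actB : forall a b u m, act (a - b) u m = act a u m - act b u m.
Hypothesis actM : forall a b u, act (a * b) u = act a (act b u).
Hypothesis act1 : forall u m, act 1 u m = u m.
Hypothesis act0 : forall u m, act 0 u m = 0.

Lemma act_comm a1 a2 f1 f2 u m : act a1 =1 f1 -> act a2 =1 f2 ->
  f1 (f2 u) = f2 (f1 u) -> act (a1 * a2 - a2 * a1) u m = 0.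
Proof. by move=> E1 E2 E; rewrite actB !actM !E1 !E2 E subrr. Qed.

Lemma act_qcomm a1 a2 c f1 f2 (b : bool) s u m : act a1 =1 f1 -> act a2 =1 f2 ->
  (forall v m', act c v m' = s * v m') ->
  f1 (f2 u) m = s ^+ b * f2 (f1 u) m + b%:R * u m ->
  act (a1 * a2 - c ^+ b * (a2 * a1) - b%:R) u m = 0.
Proof.
move=> E1 E2 Ec; rewrite !actB actM E1 E2 => ->; case: b => /=.
  rewrite !expr1 actM Ec actM E1 E2 act1; ring.
rewrite !expr0 !mul1r actM E1 E2 act0; ring.
Qed.

End AbstractAction.

(** * Action of the generators on formal series *)

Section Representation.
Variables (K : fieldType) (n : nat).
Notation L := (laurent K).
Notation mon := (multinom (n + n)).
Notation t := (laurent_poly 'X : L).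
Notation tint k := (\sum_(j < k) t ^+ j).

Implicit Types (u v : mon -> L) (m : mon).

(** The left regular representation of [qweyl], on formal series in the ordered
    monomials [x^a d^b]. *)
Definition gen_act (g : 'I_n + 'I_n) u : mon -> L := fun m =>
  match g with
  | inl i => if m (lshift n i) == 0%N then 0
             else u (mnm_sub m (mnm1 (lshift n i)))
  | inr i => t ^+ m (lshift n i)
               * (if m (rshift n i) == 0%N then 0
                  else u (mnm_sub m (mnm1 (rshift n i))))
             + tint (m (lshift n i)).+1 * u (mnm_add m (mnm1 (lshift n i)))
  end.

Definition word_act (w : seq ('I_n + 'I_n)) u := foldr gen_act u w.

Lemma gen_act_sum g (I : Type) (r : seq I) (c : I -> L) (v : I -> mon -> L) m :
  gen_act g (fun m' => \sum_(i <- r) c i * v i m') m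
    = \sum_(i <- r) c i * gen_act g (v i) m.
Proof.
case: g => i /=.
  by case: ifP => _ //; rewrite big1 // => j _; rewrite mulr0.
case: ifP => _.
  rewrite mulr0 add0r mulr_sumr; apply: eq_bigr => j _.
  by rewrite add0r mulrCA.
rewrite !mulr_sumr -big_split; apply: eq_bigr => j _ /=.
ring.
Qed.

Lemma word_act_sum w (I : Type) (r : seq I) (c : I -> L) (v : I -> mon -> L) :
  word_act w (fun m' => \sum_(i <- r) c i * v i m')
    = fun m => \sum_(i <- r) c i * word_act w (v i) m.
Proof.
elim: w => // g w /= ->; apply/funext => m.
exact: gen_act_sum.
Qed.

Notation FA := (free_alg K n).

Definition act (a : FA) u : mon -> L := fun m =>
  monalg.mmap idfun (fun w => word_act (monalg.fmonom_val w) u m) a.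

Lemma actE a u m :
  act a u m = \sum_(w <- monalg.msupp a) monalg.mcoeff w a
                * word_act (monalg.fmonom_val w) u m.
Proof. by []. Qed.

Lemma act_sum (I : Type) (r : seq I) (P : pred I) (a : I -> FA) u m :
  act (\sum_(i <- r | P i) a i) u m = \sum_(i <- r | P i) act (a i) u m.
Proof. exact: raddf_sum. Qed.

Lemma actB a b u m : act (a - b) u m = act a u m - act b u m.
Proof. exact: raddfB. Qed.

Lemma actU c w u m :
  act (@monalg.mkmalgU _ L w c) u m = c * word_act (monalg.fmonom_val w) u m.
Proof. by rewrite /act monalg.mmapU. Qed.

Lemma act0 u m : act 0 u m = 0.
Proof. exact: raddf0. Qed.

Lemma act1 u m : act 1 u m = u m.
Proof. by rewrite actU mul1r monalg.fm1. Qed.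

(** Settles the left multiples in [act_ideal]; every generator fixes the zero series. *)
Lemma act_null a : act a (fun=> 0) = fun=> 0.
Proof.
apply/funext => m; rewrite actE big1 // => w _.
rewrite (_ : word_act _ _ m = 0) ?mulr0 //.
elim: (monalg.fmonom_val w) m => // g {}w IH m /=.
rewrite -(_ : (fun=> 0) = word_act w (fun=> 0)); last by apply/funext.
by case: g => i /=; rewrite ?if_same // !mulr0 addr0.
Qed.

Lemma actM a b u : act (a * b) u = act a (act b u).
Proof.
apply/funext => m; rewrite monalg.malgME act_sum actE.
apply: eq_bigr => w _; rewrite act_sum.
rewrite (_ : act b u = fun m => \sum_(w <- monalg.msupp b)
   monalg.mcoeff w b * word_act (monalg.fmonom_val w) u m); last by apply/funext.
rewrite word_act_sum mulr_sumr; apply: eq_bigr => w' _.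
rewrite actU -mulrA; congr (_ * (_ * _)).
by rewrite monalg.fmM /word_act foldr_cat.
Qed.

Lemma act_const c u m : act (free_const n c) u m = c * u m.
Proof. by rewrite actU monalg.fm1. Qed.

Lemma act_gen g u : act (free_gen K g) u = gen_act g u.
Proof. by apply/funext => m; rewrite actU mul1r monalg.fmuE. Qed.


Lemma lrshift_eqF (i j : 'I_n) : (lshift n i == rshift n j) = false.
Proof. by rewrite eq_lrshift. Qed.

Lemma rlshift_eqF (i j : 'I_n) : (rshift n i == lshift n j) = false.
Proof. by rewrite eq_rlshift. Qed.

Let idxE := (@mnmBE (n + n), @mnmDE (n + n), @mnm1E (n + n),
  @eq_lshift n n, @eq_rshift n n,  lrshift_eqF, rlshift_eqF).

Lemma submC m1 m2 m3 : mnm_sub (mnm_sub m1 m2) m3 = mnm_sub (mnm_sub m1 m3) m2 :> mon.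
Proof. by rewrite !submDA addmC. Qed.

Lemma addmAC m1 m2 m3 : mnm_add (mnm_add m1 m2) m3 = mnm_add (mnm_add m1 m3) m2 :> mon.
Proof. by rewrite -!addmA [mnm_add m2 m3]addmC. Qed.

Lemma addm_subC m1 m2 m3 : (forall i, m3 i <= m1 i)%N ->
  mnm_sub (mnm_add m1 m2) m3 = mnm_add (mnm_sub m1 m3) m2 :> mon.
Proof. by move=> le31; apply/mnmP => i; rewrite !mnmE addnBAC. Qed.

Lemma mnm1_le m i : m i != 0%N -> forall j, (mnm1 i j <= m j)%N.
Proof. by move=> mi j; rewrite mnm1E; case: eqVneq => // <-; rewrite lt0n. Qed.

Lemma tintS k : tint k.+1 = 1 + t * tint k :> L.
Proof.
rewrite big_ord_recl expr0 mulr_sumr; congr (_ + _).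
by apply: eq_bigr => j _; rewrite -exprS.
Qed.

Lemma gen_act_xx i j u :
  gen_act (inl i) (gen_act (inl j) u) = gen_act (inl j) (gen_act (inl i) u).
Proof.
have [->//|ij] := eqVneq i j.
apply/funext => m /=; rewrite !idxE.
rewrite (eq_sym j i) (negbTE ij) !subn0 submC.
by case: ifP; case: ifP.
Qed.

Lemma gen_act_dd i j u :
  gen_act (inr i) (gen_act (inr j) u) = gen_act (inr j) (gen_act (inr i) u).
Proof.
have [->//|ij] := eqVneq i j.
apply/funext => m /=; rewrite !idxE.
rewrite (eq_sym j i) (negbTE ij) !subn0 !addn0 submC.
rewrite [mnm_add (mnm_add m _) (mnm1 (lshift n i))]addmAC.
have [mi|mi] := eqVneq (m (rshift n i)) 0%N;
  have [mj|mj] := eqVneq (m (rshift n j)) 0%N; rewrite /= ?mulr0 ?add0r.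
- by rewrite mulrCA.
- rewrite addm_subC ?mulrDr; last exact: mnm1_le.
  by rewrite mulrCA [X in _ + X]mulrCA.
- rewrite addm_subC ?mulrDr; last exact: mnm1_le.
  by rewrite mulrCA [X in _ + X]mulrCA.
- rewrite !addm_subC; try exact: mnm1_le.
  ring.
Qed.

(** Coefficientwise, the case [i = j] is [[k+1]_t = 1 + t [k]_t] with [k] the exponent of [x_i]; for
    [i <> j] the shifts of exponents commute. *)
Lemma gen_act_dx i j u m : gen_act (inr i) (gen_act (inl j) u) m
  = t ^+ (i == j) * gen_act (inl j) (gen_act (inr i) u) m + (i == j)%:R * u m.
Proof.
rewrite /= !idxE (eq_sym j i) !subn0.
have [<-|ij] := eqVneq i j.
  rewrite addn1 /= mul1r expr1 addmK.
  have [mi|mi] := eqVneq (m (lshift n i)) 0%N.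
    by rewrite if_same !mulr0 !add0r mi big_ord1 expr0 mul1r.
  rewrite submK; last by apply/mnm_lepP/mnm1_le.
  rewrite submC subn1 prednK ?lt0n //.
  case: (m (lshift n i)) mi => // k _.
  rewrite tintS [in t ^+ k.+1]exprS /=.
  case: ifP => _; ring.
rewrite expr0 mul1r mul0r addr0.
rewrite /= !addn0 !subn0.
have [mj|mj] := eqVneq (m (lshift n j)) 0%N; first by rewrite if_same !mulr0 addr0.
rewrite submC addm_subC //; exact: mnm1_le.
Qed.

Lemma act_free_relation a u : weyl_relations a -> act a u = fun=> 0.
Proof.
case=> i [j [->|->|->]]; apply/funext => m.
- exact: (act_qcomm actB actM act1 act0 (act_gen _) (act_gen _) (act_const _)
    (gen_act_dx _ _ _ _)).
- exact: (act_comm actB actM _ (act_gen _) (act_gen _) (gen_act_xx _ _ _)).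
- exact: (act_comm actB actM _ (act_gen _) (act_gen _) (gen_act_dd _ _ _)).
Qed.

Lemma act_ideal a u : ideal_gen (weyl_relations (n:=n)) a -> act a u = fun=> 0.
Proof.
(* The elements killing every series form a two-sided ideal; quantifying over [u] is what handles
   right multiples. *)
move=> Ia; apply: (Ia (fun a => forall u, act a u = fun=> 0)); split.
  split=> [v|b c b0 c0 v|b c c0 v|b c c0 v]; apply/funext => m.
  - exact: act0.
  - by rewrite actB b0 c0 subrr.
  - by rewrite actM c0 act_null.
  - by rewrite actM c0.
by move=> b Rb v; exact: act_free_relation.
Qed.
End Representation.

Section ScaledMorphism.
Variables (C A : pzRingType) (f : {rmorphism C -> A}) (a : A).
Definition scaled_morph (c : C) : A := f c * a.
Lemma scaled_morph_zmod : zmod_morphism scaled_morph.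
Proof. by move=> c d; rewrite /scaled_morph rmorphB mulrBl. Qed.
HB.instance Definition _ :=
  GRing.isZmodMorphism.Build C A scaled_morph scaled_morph_zmod.
End ScaledMorphism.

(** * Ordered monomials and their linear combinations *)

Section OrderedMonomials.
Variable n : nat.
Notation mon := (multinom (n + n)).

(** Follows the way [x^a d^b] is built by left multiplication: [d] letters are added only while all
    [x] exponents are zero, then [x] letters. *)
Lemma mnm_lr_ind (P : mon -> Prop) : P (mnm0 (n:=n + n)) ->
  (forall (m : mon) i, (forall j, m (lshift n j) = 0%N) -> P m ->
     P (mnm_add m (mnm1 (rshift n i)))) ->
  (forall (m : mon) i, P m -> P (mnm_add m (mnm1 (lshift n i)))) ->
  forall m : mon, P m.
Proof.
move=> P0 Pr Pl m; move: {2}(mdeg m) (erefl (mdeg m)) => k.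
elim: k m => [|k IH] m mk.
  by move/eqP: mk; rewrite mdeg_eq0 => /eqP ->.
have dec i : m i != 0%N ->
    m = mnm_add (mnm_sub m (mnm1 i)) (mnm1 i) /\ mdeg (mnm_sub m (mnm1 i)) = k.
  move=> mi; have E : m = mnm_add (mnm_sub m (mnm1 i)) (mnm1 i).
    by rewrite submK //; apply/mnm_lepP/mnm1_le.
  by split=> //; move: mk; rewrite {1}E mdegD mdeg1 addn1 => -[].
have [/existsP[j mj]|/existsPn ml] := boolP [exists j, m (lshift n j) != 0%N].
  by have [E mdk] := dec _ mj; rewrite E; apply: Pl; exact: IH.
have [/existsP[j mj]|/existsPn mr] := boolP [exists j, m (rshift n j) != 0%N].
  have [E mdk] := dec _ mj; rewrite E; apply: Pr; last exact: IH.
  by move=> i; rewrite mnmBE; move: (ml i); rewrite negbK => /eqP ->.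
suff m0 : m = mnm0 (n:=n + n) by rewrite m0.
apply/mnmP => i; rewrite mnm0E; case: (split_ordP i) => j ->.
  by move: (ml j); rewrite negbK => /eqP.
by move: (mr j); rewrite negbK => /eqP.
Qed.

Section Monomials.
Variables (A : pzRingType) (x d : 'I_n -> A).
Hypothesis xx : forall i j, GRing.comm (x i) (x j).
Hypothesis dd : forall i j, GRing.comm (d i) (d j).

Definition omon (m : mon) : A :=
  (\prod_(i < n) x i ^+ m (lshift n i)) * \prod_(i < n) d i ^+ m (rshift n i).

Lemma omon0 : omon (mnm0 (n:=n + n)) = 1.
Proof. by rewrite /omon !big1 ?mulr1 // => i _; rewrite mnm0E expr0. Qed.

Lemma omonX (m : mon) j : omon (mnm_add m (mnm1 (lshift n j))) = x j * omon m.
Proof.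
rewrite /omon mulrA addmC; congr (_ * _); last first.
  by apply: eq_bigr => i _; rewrite mnmDE mnm1E lrshift_eqF.
rewrite -[in RHS](prod_expr_delta x j) -comm_prod_exprD //.
by apply: eq_bigr => i _; rewrite mnmDE mnm1E eq_lshift.
Qed.

Lemma omonD (m : mon) i : (forall j, m (lshift n j) = 0%N) ->
  omon (mnm_add m (mnm1 (rshift n i))) = d i * omon m.
Proof.
move=> ml.
have prodx1 (k : mon) : (forall j, k (lshift n j) = 0%N) ->
    \prod_(j < n) x j ^+ k (lshift n j) = 1.
  by move=> k0; rewrite big1 // => j _; rewrite k0 expr0.
rewrite /omon addmC !prodx1 ?mul1r // => [|j]; last first.
  by rewrite mnmDE ml mnm1E rlshift_eqF.
rewrite -[in RHS](prod_expr_delta d i) -comm_prod_exprD //.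
by apply: eq_bigr => j _; rewrite mnmDE mnm1E eq_rshift.
Qed.
End Monomials.
End OrderedMonomials.

Section OrderedForms.
Variables (n : nat) (C : comNzRingType) (A : pzRingType) (cst : {rmorphism C -> A}).
Variables (x d : 'I_n -> A).
Notation mon := (multinom (n + n)).

(** Used twice: with the Laurent constants it is the normal form in [qweyl], and with [d_i ^+ l],
    [x_i ^+ l] in the places of [x], [d] it is [Theta], the variables [r_i] having the left
    indices. *)
Definition nform (f : mpoly (n + n) C) : A :=
  lin_ext (fun m => scaled_morph cst (omon x d m)) f.
HB.instance Definition _ := GRing.isZmodMorphism.Build _ _ nform
  (lin_ext_zmod (fun m => scaled_morph cst (omon x d m))).

Lemma nformZX c m : nform (c *: mpolyX C m) = cst c * omon x d m.
Proof. exact: lin_extZX. Qed.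

Lemma nformX m : nform (mpolyX C m) = omon x d m.
Proof. by rewrite -[mpolyX C m]scale1r nformZX rmorph1 mul1r. Qed.

Lemma nformC c : nform (mpolyC (n + n) c) = cst c.
Proof. by rewrite -[mpolyC _ c]mulr1 mul_mpolyC -mpolyX0 nformZX omon0 mulr1. Qed.

Lemma nformZ c f : nform (c *: f) = cst c * nform f.
Proof.
elim/mpolyind: f => [|e m f _ _ IH]; first by rewrite scaler0 !raddf0 mulr0.
by rewrite scalerDr scalerA !raddfD /= !nformZX IH mulrDr mulrA -rmorphM.
Qed.

Hypothesis x_central : forall i a, GRing.comm (x i) a.
Hypothesis d_central : forall i a, GRing.comm (d i) a.

Lemma omon_central m a : GRing.comm (omon x d m) a.
Proof.
apply: commr_sym; apply: commrM; apply: commr_prod => i _; apply: commrX;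
  exact: commr_sym.
Qed.

Lemma omonM (m m' : mon) : omon x d (mnm_add m m') = omon x d m * omon x d m'.
Proof.
have E (h : 'I_n -> A) (e : 'I_n -> 'I_(n + n)) : (forall i a, GRing.comm (h i) a) ->
    \prod_(i < n) h i ^+ mnm_add m m' (e i)
      = (\prod_(i < n) h i ^+ m (e i)) * \prod_(i < n) h i ^+ m' (e i).
  move=> h_central; rewrite -comm_prod_exprD; last by move=> i j; exact: h_central.
  by apply: eq_bigr => i _; rewrite mnmDE.
rewrite /omon !E //.
rewrite -!mulrA; congr (_ * _); rewrite !mulrA; congr (_ * _).
apply: commr_prod => i _; apply: commrX; apply: commr_sym; exact: d_central.
Qed.

Hypothesis cst_central : forall c a, GRing.comm (cst c) a.

Lemma nform_central f a : GRing.comm (nform f) a.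
Proof.
elim/mpolyind: f => [|e m f _ _ IH]; first by rewrite raddf0; exact/commr_sym/commr0.
rewrite raddfD /= nformZX; apply: commr_sym; apply: commrD; last exact: commr_sym.
by apply: commrM; apply: commr_sym => //; exact: omon_central.
Qed.

Lemma nformM f g : nform (f * g) = nform f * nform g.
Proof.
elim/mpolyind: f => [|c m f _ _ IH]; first by rewrite mul0r !raddf0 mul0r.
rewrite mulrDl !raddfD /= mulrDl IH; congr (_ + _).
rewrite -scalerAl !nformZ nformX -mulrA; congr (_ * _).
elim/mpolyind: g {IH} => [|e m' g _ _ IH]; first by rewrite mulr0 !raddf0 mulr0.
rewrite mulrDr !raddfD /= mulrDr -IH; congr (_ + _).
rewrite -scalerAr -mpolyXD !nformZX omonM mulrA [RHS]mulrA; congr (_ * _).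
exact: cst_central.
Qed.

End OrderedForms.

(** * Spanning and independence of the ordered monomials *)

Section PBW.
Variables (K : fieldType) (n : nat).
Notation L := (laurent K).
Notation mon := (multinom (n + n)).
Notation t := (laurent_poly 'X : L).

Variables (A : pzRingType) (cst : {rmorphism L -> A}) (x d : 'I_n -> A).
Hypothesis cst_central : forall c a, GRing.comm (cst c) a.
Hypothesis xx : forall i j, GRing.comm (x i) (x j).
Hypothesis dd : forall i j, GRing.comm (d i) (d j).
Hypothesis dx : forall i j,
  d i * x j = cst t ^+ (i == j) * (x j * d i) + (i == j)%:R.

Notation om := (omon x d).

Notation nf := (nform cst x d).

Definition in_span (z : A) := exists f, z = nf f.

Lemma in_span0 : in_span 0.
Proof. by exists 0; rewrite raddf0. Qed.

Lemma in_spanD y z : in_span y -> in_span z -> in_span (y + z).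
Proof. by move=> [f ->] [g ->]; exists (f + g); rewrite raddfD. Qed.

Lemma in_spanZ c z : in_span z -> in_span (cst c * z).
Proof. by move=> [f ->]; exists (c *: f); rewrite nformZ. Qed.

Lemma in_span_mull a : (forall m, in_span (a * om m)) ->
  forall z, in_span z -> in_span (a * z).
Proof.
move=> am z [f ->]; elim/mpolyind: f => [|e m f _ _ IH].
  by rewrite raddf0 mulr0; exact: in_span0.
rewrite raddfD /= mulrDr; apply: in_spanD => //.
by rewrite nformZX mulrA -cst_central -mulrA; apply: in_spanZ.
Qed.

Lemma in_spanx i z : in_span z -> in_span (x i * z).
Proof.
apply: in_span_mull => m; rewrite -omonX //.
exists (mpolyX L (mnm_add m (mnm1 (lshift n i)))); by rewrite nformX.
Qed.

(** Straightening by induction on the monomial: [dx] carries [d_i] past the leading [x_j], leaving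
    [d_i] in front of a shorter monomial; in front of a pure [d] monomial [omonD] absorbs it. *)
Lemma in_spand i z : in_span z -> in_span (d i * z).
Proof.
apply: in_span_mull; elim/mnm_lr_ind => [|m j m0 _|m j IH].
- exists (mpolyX L (mnm_add (mnm0 (n:=n + n)) (mnm1 (rshift n i)))).
  by rewrite nformX omonD // => j; rewrite mnm0E.
- exists (mpolyX L (mnm_add (mnm_add m (mnm1 (rshift n j))) (mnm1 (rshift n i)))).
  rewrite nformX [in RHS]omonD // => k.
  by rewrite mnmDE m0 mnm1E rlshift_eqF.
- rewrite omonX // mulrA dx mulrDl -rmorphXn /= -!mulrA.
  apply: in_spanD; first by apply: in_spanZ; apply: in_spanx.
  case: (i == j) => /=; rewrite ?mul1r ?mul0r; last exact: in_span0.
  by exists (mpolyX L m); rewrite nformX.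
Qed.

Hypothesis A_ind : forall P : A -> Prop, P 1 ->
  (forall a b, P a -> P b -> P (a + b)) -> (forall c a, P a -> P (cst c * a)) ->
  (forall i a, P a -> P (x i * a)) -> (forall i a, P a -> P (d i * a)) ->
  forall a, P a.

Lemma nform_surj a : exists f, a = nf f.
Proof.
elim/A_ind: a.
- by exists (mpolyX L (mnm0 (n:=n+n))); rewrite nformX omon0.
- exact: in_spanD.
- exact: in_spanZ.
- exact: in_spanx.
- exact: in_spand.
Qed.

Variable rho : A -> (mon -> L) -> mon -> L.
Hypothesis rhoD : forall a b u m, rho (a + b) u m = rho a u m + rho b u m.
Hypothesis rhoM : forall a b u, rho (a * b) u = rho a (rho b u).
Hypothesis rho_cst : forall c u m, rho (cst c) u m = c * u m.
Hypothesis rho_x : forall i, rho (x i) =1 gen_act (inl i).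
Hypothesis rho_d : forall i, rho (d i) =1 gen_act (inr i).

Let delta m : mon -> L := fun m' => (m == m')%:R.

(** Independence half of PBW: the action on the series [1] reads off the coefficients of a normal
    form. *)
Lemma rho_omon m : rho (om m) (delta (mnm0 (n:=n + n))) = delta m.
Proof.
elim/mnm_lr_ind: m => [|m i m0 IH|m i IH].
- by apply/funext => m; rewrite omon0 -(rmorph1 cst) rho_cst mul1r.
- rewrite omonD // rhoM IH rho_d; apply/funext => m' /=.
  rewrite /delta [X in _ + _ * X](_ : _ = 0) ?mulr0 ?addr0; last first.
    case: eqP => // /mnmP/(_ (lshift n i)).
    by rewrite m0 mnmDE mnm1E eqxx addn1.
  have [m'i|m'i] := eqVneq (m' (rshift n i)) 0%N.
    rewrite mulr0; case: eqP => // E; move: m'i; rewrite -E.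
    by rewrite mnmDE mnm1E eqxx addn1.
  have -> : (m == mnm_sub m' (mnm1 (rshift n i))) =
            (mnm_add m (mnm1 (rshift n i)) == m').
    rewrite -(eqm_add2r (mnm1 (rshift n i))) submK //.
    by apply/mnm_lepP/mnm1_le.
  case: eqP => [<-|_]; last by rewrite mulr0.
  by rewrite mnmDE m0 mnm1E rlshift_eqF expr0 mul1r.
- rewrite omonX // rhoM IH rho_x; apply/funext => m' /=.
  rewrite /delta; have [m'i|m'i] := eqVneq (m' (lshift n i)) 0%N.
    case: eqP => // E; move: m'i; rewrite -E.
    by rewrite mnmDE mnm1E eqxx addn1.
  congr (_%:R : L); congr nat_of_bool.
  rewrite -(eqm_add2r (mnm1 (lshift n i))) submK //.
  by apply/mnm_lepP/mnm1_le.
Qed.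

Lemma rho_nf f m : rho (nf f) (delta (mnm0 (n:=n + n))) m = mcoeff m f.
Proof.
elim/mpolyind: f => [|e k f _ _ IH].
  by rewrite !raddf0 -(rmorph0 cst) rho_cst mul0r.
by rewrite raddfD /= rhoD IH nformZX rhoM rho_cst rho_omon mcoeffD mcoeffZ mcoeffX.
Qed.

Lemma nform_eq0 f : nf f = 0 -> f = 0.
Proof.
move=> f0; apply/mpolyP => m; rewrite -rho_nf f0 mcoeff0.
by rewrite -(rmorph0 cst) rho_cst mul0r.
Qed.

(** By PBW, multiplication by [c] acts coefficient by coefficient on unique normal forms. *)
Lemma cst_regular (c : L) : GRing.lreg c -> forall a, cst c * a = 0 -> a = 0.
Proof.
move=> c_reg a; have [f ->] := nform_surj a.
rewrite -nformZ => /nform_eq0 cf0.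
suff -> : f = 0 by rewrite raddf0.
by apply/mpolyP => m; apply: c_reg; rewrite -mcoeffZ cf0 !mcoeff0 mulr0.
Qed.

End PBW.

(** * The bracket as a biderivation *)

Section QuantizedBracket.
Variables (A B : pzRingType) (pi : {rmorphism A -> B}) (tau : A) (lam : B).
Hypothesis tau_central : forall a, GRing.comm tau a.
Hypothesis tau_regular : forall a, tau * a = 0 -> a = 0.
Hypothesis pi_ker : forall a, pi a = 0 -> exists b, a = tau * b.
Hypothesis lam_central : forall b, GRing.comm lam b.

(** This is [is_poisson_q] with the algebras left abstract: [tau] plays [t - q] and [lam] the scalar
    [lambda]. *)
Definition qbracket (P Q V : B) : Prop :=
  [/\ forall b, P * b = b * P, forall b, Q * b = b * Q &
    exists Pt Qt C : A,
      [/\ pi Pt = P, pi Qt = Q, tau * C = Pt * Qt - Qt * Pt & V = lam * pi C]].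

(** Changing the lift by [tau * U] changes the quotient [C] by the commutator of [U] and [Qt], which
    [pi] kills since [pi Qt] is central. *)
Lemma qbracket_liftl Pt Pt' Qt C : (forall b, pi Qt * b = b * pi Qt) ->
  tau * C = Pt * Qt - Qt * Pt -> pi Pt' = pi Pt ->
  exists C', tau * C' = Pt' * Qt - Qt * Pt' /\ pi C' = pi C.
Proof.
move=> cQ EC /eqP; rewrite -subr_eq0 -rmorphB => /eqP /pi_ker[U EU].
have -> : Pt' = Pt + tau * U by rewrite -EU addrC subrK.
exists (C + (U * Qt - Qt * U)); split.
  rewrite mulrDr EC mulrBr !mulrDl !mulrDr opprD !mulrA.
  by rewrite -[Qt * tau]tau_central addrACA.
by rewrite rmorphD rmorphB !rmorphM /= cQ subrr addr0.
Qed.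

Lemma qbracketC P Q V : qbracket P Q V -> qbracket Q P (- V).
Proof.
case=> cP cQ [Pt [Qt [C [EP EQ EC ->]]]]; split=> //.
exists Qt, Pt, (- C); split=> //; first by rewrite mulrN EC opprB.
by rewrite rmorphN mulrN.
Qed.

Lemma qbracket_lift P Q V Pt Qt : qbracket P Q V -> pi Pt = P -> pi Qt = Q ->
  exists C, tau * C = Pt * Qt - Qt * Pt /\ V = lam * pi C.
Proof.
case=> cP cQ [P0 [Q0 [C [EP0 EQ0 EC ->]]]] EP EQ.
(* The lift of [P] is changed first; antisymmetry then turns the same lemma into a change of the
   lift of [Q]. *)
have [C1 [EC1 <-]] : exists C', tau * C' = Pt * Q0 - Q0 * Pt /\ pi C' = pi C.
  by apply: qbracket_liftl EC _; rewrite ?EQ0 // EP.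
have [|||C2 [EC2 EC21]] := @qbracket_liftl Q0 Qt Pt (- C1).
- by rewrite EP.
- by rewrite mulrN EC1 opprB.
- by rewrite EQ.
exists (- C2); split; first by rewrite mulrN EC2 opprB.
by rewrite rmorphN EC21 rmorphN opprK.
Qed.

Lemma qbracket_unique P Q V V' : qbracket P Q V -> qbracket P Q V' -> V = V'.
Proof.
case=> cP cQ [Pt [Qt [C [EP EQ EC ->]]]] H'.
have [C' [EC' ->]] := qbracket_lift H' EP EQ.
congr (_ * pi _); apply/eqP; rewrite -subr_eq0; apply/eqP/tau_regular.
by rewrite mulrBr EC EC' subrr.
Qed.

Lemma qbracketD P P' Q V V' : qbracket P Q V -> qbracket P' Q V' ->
  qbracket (P + P') Q (V + V').
Proof.
case=> cP cQ [Pt [Qt [C [EP EQ EC ->]]]] H'.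
have [cP' _ [Pt' [_ [_ [EP' _ _ _]]]]] := H'.
have [C' [EC' ->]] := qbracket_lift H' EP' EQ.
split=> // [b|]; first by rewrite mulrDl mulrDr cP cP'.
exists (Pt + Pt'), Qt, (C + C'); split=> //.
- by rewrite rmorphD EP EP'.
- by rewrite mulrDr EC EC' mulrDl mulrDr opprD addrACA.
- by rewrite rmorphD mulrDr.
Qed.

(** The identity [[ab, c] = a[b, c] + [a, c]b] is applied to lifts sharing the same [Qt]; centrality
    of [lam] pulls it to the front. *)
Lemma qbracketM P P' Q V V' : qbracket P Q V -> qbracket P' Q V' ->
  qbracket (P * P') Q (P * V' + V * P').
Proof.
case=> cP cQ [Pt [Qt [C [EP EQ EC ->]]]] H'.
have [cP' _ [Pt' [_ [_ [EP' _ _ _]]]]] := H'.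
have [C' [EC' ->]] := qbracket_lift H' EP' EQ.
split=> // [b|]; first by rewrite -mulrA cP' mulrA cP mulrA.
exists (Pt * Pt'), Qt, (Pt * C' + C * Pt'); split=> //.
- by rewrite rmorphM EP EP'.
- rewrite mulrDr mulrA tau_central -mulrA EC' mulrA EC.
  by rewrite mulrBr mulrBl !mulrA addrA subrK.
- rewrite rmorphD !rmorphM /= EP EP' mulrDr; congr (_ + _); last by rewrite mulrA.
  by rewrite !mulrA lam_central.
Qed.

Lemma qbracket_comm Pt Qt : (forall b, pi Pt * b = b * pi Pt) ->
  (forall b, pi Qt * b = b * pi Qt) -> Pt * Qt = Qt * Pt ->
  qbracket (pi Pt) (pi Qt) 0.
Proof.
move=> cP cQ PQ; split=> //; exists Pt, Qt, 0; split=> //.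
  by rewrite mulr0 PQ subrr.
by rewrite rmorph0 mulr0.
Qed.

End QuantizedBracket.

(** * The deformed Poisson bracket on polynomials *)

Section DeformedBracket.
Variables (n : nat) (K : fieldType) (c : K).
Notation O := (mpoly (n + n) K).
Notation "''r_' i" := (mpolyX K (mnm1 (lshift n i))) (at level 8, i at level 2).
Notation "''s_' i" := (mpolyX K (mnm1 (rshift n i))) (at level 8, i at level 2).

(** The bracket on [O_{2n}] transported from the centre of the quantized Weyl
    algebra at a root of unity. *)
Definition poisson_def (f g : O) : O :=
  \sum_(i < n) (1 + c *: ('r_i * 's_i)) *
    (mderiv (lshift n i) f * mderiv (rshift n i) g
     - mderiv (lshift n i) g * mderiv (rshift n i) f).

Lemma poisson_defC f g : poisson_def g f = - poisson_def f g.
Proof. by rewrite /poisson_def -sumrN; apply: eq_bigr => i _; ring. Qed.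

Lemma poisson_defD f f' g :
  poisson_def (f + f') g = poisson_def f g + poisson_def f' g.
Proof.
rewrite /poisson_def -big_split; apply: eq_bigr => i _ /=.
by rewrite !mderivD; ring.
Qed.

Lemma poisson_defM f f' g :
  poisson_def (f * f') g = f * poisson_def f' g + poisson_def f g * f'.
Proof.
rewrite /poisson_def mulr_sumr mulr_suml -big_split; apply: eq_bigr => i _ /=.
by rewrite !mderivM; ring.
Qed.

Lemma poisson_def_const e g : poisson_def (mpolyC (n + n) e) g = 0.
Proof.
by rewrite /poisson_def big1 // => i _; rewrite !mderivC !(mul0r, mulr0) subrr mulr0.
Qed.

Lemma mderivXU (i j : 'I_(n + n)) :
  mderiv i (mpolyX K (mnm1 j)) = (j == i)%:R :> O.
Proof.
rewrite mderivX mnm1E; case: eqP => [->|_]; last by rewrite scale0r.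
by rewrite scale1r -[X in mnm_sub X]add0m addmK mpolyX0.
Qed.

Lemma poisson_def_rr i j : poisson_def 'r_i 'r_j = 0.
Proof.
rewrite /poisson_def big1 // => k _.
by rewrite !mderivXU !lrshift_eqF mulr0 mulr0 subrr mulr0.
Qed.

Lemma poisson_def_ss i j : poisson_def 's_i 's_j = 0.
Proof.
rewrite /poisson_def big1 // => k _.
by rewrite !mderivXU !rlshift_eqF mul0r mul0r subrr mulr0.
Qed.

Lemma poisson_def_rs i j :
  poisson_def 'r_i 's_j = (i == j)%:R * (1 + c *: ('r_i * 's_i)).
Proof.
rewrite /poisson_def (bigD1 i) //= big1 => [|k ki]; rewrite !mderivXU.
  by rewrite !rlshift_eqF !eq_lshift !eq_rshift eqxx mul0r subr0 addr0 mul1r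
    mulrC eq_sym.
by rewrite !rlshift_eqF !eq_lshift eq_sym (negbTE ki) mul0r mul0r subrr mulr0.
Qed.

(** Isolates the deformation: in the limit only the scalar [c] depends on [l]. *)
Lemma poisson_defE f g : poisson_def f g = poisson_std f g + c *:
  \sum_(i < n) ('r_i * 's_i) *
    (mderiv (lshift n i) f * mderiv (rshift n i) g
     - mderiv (lshift n i) g * mderiv (rshift n i) f).
Proof.
rewrite /poisson_def /poisson_std scaler_sumr -big_split; apply: eq_bigr => i _ /=.
by rewrite mulrDl mul1r -scalerAl.
Qed.

Variables (A B : pzRingType) (pi : {rmorphism A -> B}) (tau : A) (lam : B).
Hypothesis tau_central : forall a, GRing.comm tau a.
Hypothesis tau_regular : forall a, tau * a = 0 -> a = 0.
Hypothesis pi_ker : forall a, pi a = 0 -> exists b, a = tau * b.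
Hypothesis pi_surj : forall b, exists a, pi a = b.
Hypothesis lam_central : forall b, GRing.comm lam b.

Variables (cst : {rmorphism K -> B}) (y z : 'I_n -> B).
Hypothesis cst_lift : forall e, exists2 a, pi a = cst e & forall b, GRing.comm a b.
Hypothesis y_central : forall i a, GRing.comm (y i) a.
Hypothesis z_central : forall i a, GRing.comm (z i) a.

Notation qbr := (qbracket pi tau lam).
Notation nf := (nform cst y z).

Hypothesis qbr_yy : forall i j, qbr (y i) (y j) 0.
Hypothesis qbr_zz : forall i j, qbr (z i) (z j) 0.
Hypothesis qbr_yz : forall i j,
  qbr (y i) (z j) ((i == j)%:R * (1 + cst c * (y i * z i))).

Lemma cst_central e b : GRing.comm (cst e) b.
Proof.
have [a <- a_c] := cst_lift e; have [b' <-] := pi_surj b.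
by rewrite /GRing.comm -!rmorphM a_c.
Qed.

Let nfc f b : nf f * b = b * nf f.
Proof. exact: (nform_central y_central z_central cst_central). Qed.

Let nfM f g : nf (f * g) = nf f * nf g.
Proof. exact: (nformM y_central z_central cst_central). Qed.

Definition nform_hom f g := qbr (nf f) (nf g) (nf (poisson_def f g)).

Lemma nform_homC f g : nform_hom f g -> nform_hom g f.
Proof. by move=> /qbracketC H; rewrite /nform_hom poisson_defC raddfN. Qed.

Lemma nform_homD f f' g : nform_hom f g -> nform_hom f' g -> nform_hom (f + f') g.
Proof.
move=> H H'; rewrite /nform_hom poisson_defD !raddfD.
exact: qbracketD H H'.
Qed.

Lemma nform_homM f f' g : nform_hom f g -> nform_hom f' g -> nform_hom (f * f') g.
Proof.
move=> H H'; rewrite /nform_hom poisson_defM raddfD /= !nfM.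
exact: qbracketM H H'.
Qed.

Lemma nform_hom_const e g : nform_hom (mpolyC (n + n) e) g.
Proof.
have cc := nfc (mpolyC (n + n) e); have cg := nfc g.
rewrite /nform_hom poisson_def_const raddf0; move: cc; rewrite nformC.
have [a <- a_c] := cst_lift e; have [b Eb] := pi_surj (nf g).
by rewrite -Eb in cg *; move=> cc; apply: qbracket_comm => //; exact: a_c.
Qed.

(** Both brackets are derivations in the first argument that vanish on constants, so agreement
    spreads from the variables to all polynomials. *)
Lemma nform_hom_gen g : (forall i, nform_hom (mpolyX K (mnm1 i)) g) ->
  forall f, nform_hom f g.
Proof.
move=> genH; elim/mpolyind => [|e m f _ _ IH].
  by rewrite -(mpolyC0 (n + n) K); exact: nform_hom_const.
apply: nform_homD => //; rewrite -mul_mpolyC; apply: nform_homM.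
  exact: nform_hom_const.
elim/mnm_lr_ind: m => [|m i _ IHm|m i IHm].
- by rewrite mpolyX0; exact: nform_hom_const.
- by rewrite mpolyXD; apply: nform_homM.
- by rewrite mpolyXD; apply: nform_homM.
Qed.

Lemma nform_poisson f g : nform_hom f g.
Proof.
have nfr i : nf 'r_i = y i.
  by rewrite nformX -[mnm1 _]add0m omonX ?omon0 ?mulr1 // => j k; exact: y_central.
have nfs i : nf 's_i = z i.
  have z_comm j k : GRing.comm (z j) (z k) by exact: z_central.
  by rewrite nformX -[mnm1 _]add0m omonD ?omon0 ?mulr1 // => j; rewrite mnm0E.
have rs i j : nform_hom 'r_i 's_j.
  rewrite /nform_hom poisson_def_rs nfr nfs.
  rewrite (_ : nf _ = (i == j)%:R * (1 + cst c * (y i * z i))) //.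
  rewrite mulr_natl raddfMn raddfD /= nformZ nfM nfr nfs.
  by rewrite -mpolyC1 nformC rmorph1 mulr_natl.
(* Antisymmetry lets the reduction to variables be applied to each argument in turn. *)
apply: nform_hom_gen => k; apply: nform_homC; apply: nform_hom_gen => k'.
case: (split_ordP k) => i ->; case: (split_ordP k') => j ->.
- by rewrite /nform_hom poisson_def_rr !nfr raddf0.
- exact/nform_homC/rs.
- exact: rs.
- by rewrite /nform_hom poisson_def_ss !nfs raddf0.
Qed.

End DeformedBracket.

(** * Commutation of powers and evaluation at a root of unity *)

Section PowerCommutation.
Variable K : fieldType.

(** Polynomial form of [[k]_t], which allows evaluation at [1] and division by [t - q]. *)
Definition qnum (k : nat) : {poly K} := \sum_(j < k) 'X^j.

Lemma qnum0 : qnum 0 = 0.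
Proof. by rewrite /qnum big_ord0. Qed.

Lemma qnumSl k : qnum k.+1 = 'X * qnum k + 1.
Proof.
rewrite /qnum big_ord_recl expr0 addrC mulr_sumr; congr (_ + _).
by apply: eq_bigr => j _; rewrite -exprS.
Qed.

Lemma qnumM1 k : qnum k * ('X - 1) = 'X^k - 1.
Proof. by rewrite mulrC /qnum -subrX1. Qed.

(** Falling factorial [[l]_t [l-1]_t ... [l-k+1]_t]; for [k = l] it is [[l]_t!]. *)
Definition qfall (l k : nat) : {poly K} := \prod_(j < k) qnum (l - j).

(** [dcoef l m k * qfall l k] is the coefficient of [x^(l-k) d^(m-k)] in
    [d^m x^l]; up to a power of ['X], [dcoef l m k] is the Gaussian binomial. *)
Fixpoint dcoef (l m k : nat) : {poly K} :=
  match m, k with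
  | 0, 0 => 1
  | 0, _.+1 => 0
  | m.+1, 0 => 'X^l * dcoef l m 0
  | m.+1, k.+1 => 'X^(l - k.+1) * dcoef l m k.+1 + dcoef l m k
  end.

Lemma dcoef_gt l m k : (m < k)%N -> dcoef l m k = 0.
Proof.
elim: m k => [|m IH] [|k] //= mk.
by rewrite !IH ?mulr0 ?addr0 // ltnW.
Qed.

Lemma dcoefmm l m : dcoef l m m = 1.
Proof. by elim: m => //= m ->; rewrite dcoef_gt // mulr0 add0r. Qed.

Lemma dcoefm0 l m : dcoef l m 0 = 'X^(l * m).
Proof. by elim: m => [|m IH] /=; rewrite ?muln0 // IH mulnS exprD. Qed.

Section Ring.
Variables (A : pzRingType) (cst : {rmorphism {poly K} -> A}) (x d : A).
Hypothesis cst_central : forall p a, GRing.comm (cst p) a.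
Hypothesis dx : d * x = cst 'X * (x * d) + 1.

Let cstCA p y z : y * (cst p * z) = cst p * (y * z).
Proof. by rewrite mulrA -cst_central mulrA. Qed.

Lemma mul_d_xn k : d * x ^+ k = cst 'X^k * (x ^+ k * d) + cst (qnum k) * x ^+ k.-1.
Proof.
elim: k => [|k IH].
  by rewrite qnum0 rmorph0 mul0r addr0 expr0 rmorph1 !mul1r mulr1.
rewrite [x ^+ k.+1]exprS mulrA dx mulrDl mul1r -!mulrA IH qnumSl.
rewrite rmorphD rmorph1 rmorphM /= mulrDl mul1r addrA; congr (_ + _).
rewrite !mulrDr ![x * (cst _ * _)]cstCA exprS rmorphM /= !mulrA; congr (_ + _).
(* At [k = 0] the truncated exponent [k.-1] does no harm, since [qnum 0 = 0]. *)
case: k {IH} => [|k]; first by rewrite qnum0 rmorph0 !(mulr0, mul0r).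
by rewrite -mulrA -exprS.
Qed.

Lemma mul_dn_x k : d ^+ k * x = cst 'X^k * (x * d ^+ k) + cst (qnum k) * d ^+ k.-1.
Proof.
elim: k => [|k IH].
  by rewrite qnum0 rmorph0 mul0r addr0 expr0 rmorph1 !mul1r mulr1.
rewrite exprSr -mulrA dx mulrDr mulr1 cstCA [d ^+ k * _]mulrA IH.
rewrite qnumSl rmorphD rmorph1 rmorphM /= [in RHS]mulrDl mul1r addrA; congr (_ + _).
rewrite mulrDl mulrDr exprS rmorphM /= -!mulrA -exprSr; congr (_ + _ * _).
case: k {IH} => [|k]; first by rewrite qnum0 rmorph0 !mul0r.
by rewrite -exprSr.
Qed.

(** Induction on [m]: one more [d] either passes all of [x^(l-k)], giving [a k], or consumes one [x]
    and extends [qfall] by [[l-k]_t], giving [b k]. Collecting equal monomials yields the recursion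
    of [dcoef]. *)
Lemma mul_dm_xl l m : d ^+ m * x ^+ l =
  \sum_(k < m.+1) cst (dcoef l m k * qfall l k) * (x ^+ (l - k) * d ^+ (m - k)).
Proof.
elim: m => [|m IH].
  by rewrite big_ord1 /= /qfall big_ord0 mulr1 rmorph1 subn0 !expr0 !mul1r mulr1.
rewrite exprS -mulrA IH mulr_sumr.
pose a k := cst ('X^(l - k) * dcoef l m k * qfall l k)
              * (x ^+ (l - k) * d ^+ (m.+1 - k)).
pose b k := cst (dcoef l m k * qfall l k.+1) * (x ^+ (l - k.+1) * d ^+ (m - k)).
transitivity (\sum_(k < m.+1) (a k + b k)).
  apply: eq_bigr => k _; rewrite mulrA -cst_central -mulrA [d * _]mulrA mul_d_xn /a /b.
  rewrite mulrDl mulrDr; congr (_ + _).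
    rewrite -mulrA -[_ * d * _]mulrA -exprS subSn -1?ltnS // mulrA -rmorphM.
    by congr (cst _ * _); rewrite mulrC mulrA.
  rewrite -mulrA mulrA -rmorphM subnS; congr (cst _ * _).
  by rewrite [qfall l k.+1]big_ord_recr mulrA.
rewrite big_split /= [in RHS]big_ord_recl /=.
rewrite [X in _ = _ + X](_ : _ = \sum_(k < m.+1) (a k.+1 + b k)); last first.
  apply: eq_bigr => k _; rewrite /a /b /bump /= add1n subSS -mulrDl -rmorphD.
  congr (cst _ * _).
  ring.
rewrite big_split /= addrA; congr (_ + _).
rewrite [in RHS]big_ord_recr /= [in LHS]big_ord_recl.
rewrite (_ : a m.+1 = 0) ?addr0; last first.
  by rewrite /a dcoef_gt // mulr0 mul0r rmorph0 mul0r.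
by congr (_ + _); rewrite /a subn0.
Qed.

End Ring.

(** * Evaluation at a primitive root of unity *)

Section RootOfUnity.
Variables (q : K) (l : nat).
Hypothesis l_gt1 : (1 < l)%N.
Hypothesis q_prim : l.-primitive_root q.
Hypothesis l_neq0 : l%:R != 0 :> K.

Let q_neq0 : q != 0.
Proof.
apply: contraTneq l_gt1 => q0; have := prim_expr_order q_prim.
rewrite q0 expr0n; case: l => // k /eqP; by rewrite /= eq_sym oner_eq0.
Qed.

Let qX_neq1 k : (0 < k < l)%N -> 1 - q ^+ k != 0.
Proof.
case/andP=> k0 kl; rewrite subr_eq0 eq_sym -(prim_order_dvd q_prim).
by apply: contraTN kl => /(dvdn_leq k0); rewrite -leqNgt.
Qed.

Let q_neq1 : q - 1 != 0.
Proof. by have := @qX_neq1 1; rewrite l_gt1 expr1 -oppr_eq0 opprB; apply. Qed.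

(** Since [q ^+ l = 1], the recursion of [dcoef] becomes at [q] the Pascal rule of Gaussian
    binomials in base [q^-1], and this is the ratio of two neighbours. The factor [q^-1 ^+ k] avoids
    the truncated exponent [m - k]. *)
Lemma dcoef_rec m k : (k < l)%N ->
  (1 - q^-1 ^+ k.+1) * q^-1 ^+ k * (dcoef l m k.+1).[q]
    = (q^-1 ^+ k - q^-1 ^+ m) * (dcoef l m k).[q].
Proof.
have qB j : (j <= l)%N -> q ^+ (l - j) = q^-1 ^+ j.
  move=> jl; apply: (mulIf (expf_neq0 j q_neq0)).
  by rewrite -exprD subnK // (prim_expr_order q_prim) exprVn mulVf // expf_neq0.
elim: m k => [|m IH] k kl.
  case: k {kl} => [|k] /=; first by rewrite !hornerE subrr ?mul0r ?mulr0.
  by rewrite !hornerE ?mulr0.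
rewrite /= !hornerE qB //.
case: k kl => [|k] kl /=.
have := IH 0%N (ltnW l_gt1); rewrite [('X^l * _).[q]]hornerM hornerXn.
  rewrite (prim_expr_order q_prim).
  set e0 := (dcoef l m 0).[q]; set e1 := (dcoef l m 1).[q] => E.
  transitivity (q^-1 * ((1 - q^-1 ^+ 1) * q^-1 ^+ 0 * e1) + (1 - q^-1) * e0).
    by ring.
  rewrite E exprS; ring.
rewrite !hornerE qB; last exact: ltnW.
have E1 := IH _ kl; have E2 := IH k (ltnW kl).
rewrite mulrDr [_ * (q^-1 ^+ k.+2 * _)]mulrCA E1.
rewrite [RHS]mulrDr.
have -> : (q^-1 ^+ k.+1 - q^-1 ^+ m.+1) * (dcoef l m k).[q] =
   q^-1 * ((q^-1 ^+ k - q^-1 ^+ m) * (dcoef l m k).[q]) by rewrite !exprS; ring.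
rewrite -E2 !exprS; ring.
Qed.

(** For [m = l] the ratio from [k = 0] to [k = 1] contains [1 - q^-1 ^+ l = 0]; the vanishing then
    propagates as long as [1 - q^-1 ^+ k.+1] is nonzero. *)
Lemma dcoef_root k : (0 < k < l)%N -> (dcoef l l k).[q] = 0.
Proof.
have pl : q^-1 ^+ l = 1 by rewrite exprVn (prim_expr_order q_prim) invr1.
have coef_neq0 j : (j.+1 < l)%N -> (1 - q^-1 ^+ j.+1) * q^-1 ^+ j != 0.
  move=> jl; rewrite mulf_neq0 ?expf_neq0 ?invr_eq0 //.
  by rewrite subr_eq0 eq_sym exprVn invr_eq1 eq_sym -subr_eq0 qX_neq1.
case: k => // k /=; elim: k => [|k IH] kl; apply: (mulfI (coef_neq0 _ kl)).
  by rewrite mulr0 dcoef_rec ?(ltnW kl) // pl expr0 subrr mul0r.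
by rewrite dcoef_rec ?(ltnW kl) // IH ?(ltnW kl) // !mulr0.
Qed.

Lemma qnum_eval k : (qnum k).[q] * (q - 1) = q ^+ k - 1.
Proof. by have := congr1 (horner^~ q) (qnumM1 k); rewrite /= !hornerE. Qed.

Lemma qnum_root : (qnum l).[q] = 0.
Proof.
by apply: (mulIf q_neq1); rewrite qnum_eval (prim_expr_order q_prim) subrr mul0r.
Qed.

Definition qnum_quo : {poly K} := qnum l %/ ('X - q%:P).

Lemma qnum_quoE : qnum l = ('X - q%:P) * qnum_quo.
Proof. by rewrite mulrC divpK // dvdp_XsubCl rootE qnum_root. Qed.

(** The quantum factorial of [l], divided by [t - q] *)
Definition qfall_quo : {poly K} := qnum_quo * qfall l.-1 l.-1.

Lemma qfall_consE k : qfall l k.+1 = ('X - q%:P) * (qnum_quo * qfall l.-1 k).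
Proof.
rewrite /qfall big_ord_recl subn0 qnum_quoE -mulrA; congr (_ * (_ * _)).
by apply: eq_bigr => j _; rewrite lift0 -subn1 -subnDA.
Qed.

Lemma qfallll : qfall l l = ('X - q%:P) * qfall_quo.
Proof. by have := qfall_consE l.-1; rewrite (prednK (ltnW l_gt1)). Qed.

(** Value at [1] of [(X^l - 1) / (X - 1)], computed as a sum of powers and as a product over the
    nontrivial [l]-th roots of unity. *)
Lemma prod_1BqX : \prod_(k < l.-1) (1 - q ^+ k.+1) = l%:R.
Proof.
have X1 : 'X - 1 != 0 :> {poly K} by rewrite -polyC1 polyXsubC_eq0.
have E : qnum l = \prod_(k < l.-1) ('X - (q ^+ k.+1)%:P).
  apply: (mulIf X1); rewrite qnumM1 -(factor_Xn_sub_1 q_prim).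
  by rewrite big_ltn ?(ltnW l_gt1) // big_add1 big_mkord expr0 mulrC.
have <- : (qnum l).[1] = l%:R.
  rewrite /qnum horner_sum (eq_bigr (fun=> 1)) => [|j _]; last first.
    by rewrite !hornerE expr1n.
  by rewrite sumr_const card_ord.
by rewrite E horner_prod; apply: eq_bigr => k _; rewrite !hornerE.
Qed.

(** The right side is the derivative of [X^(l * l)] at [q], so [- (1 - q) ^+ l] is the ratio of the
    two extreme terms in the expansion of the commutator. *)
Lemma qfall_quo_eval : qfall_quo.[q] * - (1 - q) ^+ l = l%:R ^+ 2 * q ^+ l.-1.
Proof.
(* Differentiate [[l]_t (t - 1) = t^l - 1] at the root [q] of [[l]_t]. *)
have quoE : qnum_quo.[q] * (q - 1) = l%:R * q ^+ l.-1.
  have := congr1 (fun p => p^`().[q]) (qnumM1 l).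
  rewrite /= qnum_quoE !poly.derivE !hornerE.
  by rewrite subrr !mul0r !addr0 subr0 hornerMn hornerXn mulr_natl.
(* Each of the [l - 1] factors [1 - q] turns one quantum integer into some [1 - q^k]. *)
have fallE : (qfall l.-1 l.-1).[q] * (1 - q) ^+ l.-1 = l%:R.
  have -> : (1 - q) ^+ l.-1 = \prod_(k < l.-1) (1 - q) by rewrite prodr_const card_ord.
  rewrite -prod_1BqX /qfall horner_prod -big_split (reindex_inj rev_ord_inj) /=.
  apply: eq_bigr => k _; rewrite subKn; last exact: ltn_ord.
  by apply: oppr_inj; rewrite -mulrN opprB qnum_eval opprB.
rewrite hornerM -[X in (1 - q) ^+ X](prednK (ltnW l_gt1)) exprS.
transitivity ((qnum_quo.[q] * (q - 1)) * ((qfall l.-1 l.-1).[q] * (1 - q) ^+ l.-1)).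
  ring.
rewrite quoE fallE; ring.
Qed.

Lemma qfall_quo_neq0 : qfall_quo.[q] != 0.
Proof.
apply: contra_eq_neq (qfall_quo_eval) => ->; rewrite mul0r eq_sym.
by rewrite mulf_neq0 // expf_neq0.
Qed.

Variables (A B : pzRingType) (cst : {rmorphism {poly K} -> A}) (x d : A).
Variables (pi : {rmorphism A -> B}) (cst_at : {rmorphism K -> B}).
Hypothesis cst_central : forall p a, GRing.comm (cst p) a.
Hypothesis dx : d * x = cst 'X * (x * d) + 1.
Hypothesis pi_cst : forall p, pi (cst p) = cst_at p.[q].

Lemma pi_d_xl : pi d * pi x ^+ l = pi x ^+ l * pi d.
Proof.
have := congr1 pi (mul_d_xn cst_central dx l).
rewrite rmorphD !rmorphM /= !pi_cst hornerXn qnum_root (prim_expr_order q_prim).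
by rewrite rmorph1 rmorph0 mul1r mul0r addr0 !rmorphXn.
Qed.

Lemma pi_dl_x : pi d ^+ l * pi x = pi x * pi d ^+ l.
Proof.
have := congr1 pi (mul_dn_x cst_central dx l).
rewrite rmorphD !rmorphM /= !pi_cst hornerXn qnum_root (prim_expr_order q_prim).
by rewrite rmorph1 rmorph0 mul1r mul0r addr0 !rmorphXn.
Qed.

Lemma comm_dl_xl : exists C,
  cst ('X - q%:P) * C = d ^+ l * x ^+ l - x ^+ l * d ^+ l /\
  pi C = cst_at qfall_quo.[q] *
           (1 + cst_at (- (1 - q) ^+ l) * (pi d ^+ l * pi x ^+ l)).
Proof.
have l_gt0 : (0 < l)%N by exact: ltnW.
have q_factor p : p.[q] = 0 -> exists r, p = ('X - q%:P) * r.
  by move=> /rootP/factor_theorem[r ->]; exists r; rewrite mulrC.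
have [u Eu] : exists u, 'X^(l * l) - 1 = ('X - q%:P) * u.
  by apply: q_factor; rewrite !hornerE exprM (prim_expr_order q_prim) expr1n subrr.
(* Differentiating [Eu] at [q] gives [u.[q] = l^2 q^(l-1)], the right side of [qfall_quo_eval]. *)
have uq : u.[q] = qfall_quo.[q] * - (1 - q) ^+ l.
  rewrite qfall_quo_eval; have := congr1 (fun p => p^`().[q]) Eu.
  rewrite /= !poly.derivE !hornerE subrr mul0r addr0 subr0 => <-.
  rewrite hornerMn hornerXn -mulr_natl natrM expr2; congr (_ * _).
  have -> : (l * l).-1 = (l * l.-1 + l.-1)%N.
    by case: (l) l_gt0 => // l' _; rewrite mulnS addSn addnC.
  by rewrite exprD exprM (prim_expr_order q_prim) expr1n mul1r.
(* A middle coefficient has two factors [t - q], one from [dcoef] and one from [[l]_t] in [qfall];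
   after one division by [t - q] it still vanishes at [q]. *)
pose h k : {poly K} := dcoef l l k %/ ('X - q%:P).
have hE (k : 'I_l.-1) : dcoef l l k.+1 = ('X - q%:P) * h k.+1.
  by rewrite mulrC divpK // dvdp_XsubCl rootE dcoef_root //= -ltn_predRL.
pose g k := h k.+1 * (qnum_quo * qfall l.-1 k).
pose w k := x ^+ (l - k) * d ^+ (l - k).
pose C := cst u * w 0%N + \sum_(k < l.-1) cst (('X - q%:P) * g k) * w k.+1
          + cst qfall_quo.
have CE : cst ('X - q%:P) * C = d ^+ l * x ^+ l - x ^+ l * d ^+ l.
  have split3 (F : nat -> A) :
      \sum_(k < l.+1) F k = F 0%N + \sum_(k < l.-1) F k.+1 + F l.
    by case: (l) l_gt0 => // l' _; rewrite big_ord_recl big_ord_recr addrA.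
  rewrite (mul_dm_xl cst_central dx)
    (split3 (fun k => cst (dcoef l l k * qfall l k) * w k)).
  have -> : w l = 1 by rewrite /w subnn !expr0 mulr1.
  rewrite dcoefmm mul1r dcoefm0 mulr1 qfallll {1}/qfall big_ord0 mulr1.
  (* Subtracting [x^l d^l] turns the coefficient [X^(l * l)] of [w 0] into [X^(l * l) - 1]. *)
  rewrite -(subrK 1 'X^(l * l)) Eu [cst (_ + 1)]rmorphD rmorph1 mulrDl mul1r.
  have -> : x ^+ l * d ^+ l = w 0%N by rewrite /w subn0.
  rewrite -!addrA [w 0%N + (_ + _)]addrC !addrA subrK /C !mulrDr.
  congr (_ + _ + _); last by rewrite -rmorphM.
    by rewrite mulrA -rmorphM.
  rewrite mulr_sumr; apply: eq_bigr => k _; rewrite mulrA -rmorphM hE qfall_consE.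
  by congr (cst _ * _); rewrite /g; ring.
exists C; split=> //.
(* The commutator is a multiple of [t - q], hence dies under [pi], so the two factors of [w 0] may
   be exchanged there. *)
have pi_comm : pi x ^+ l * pi d ^+ l = pi d ^+ l * pi x ^+ l.
  have /eqP := congr1 pi CE; rewrite rmorphM /= pi_cst hornerXsubC subrr rmorph0 mul0r.
  by rewrite rmorphB !rmorphM !rmorphXn eq_sym subr_eq0 => /eqP.
rewrite /C !rmorphD rmorph_sum big1 ?addr0 => [|k _]; last first.
  by rewrite rmorphM /= pi_cst hornerM hornerXsubC subrr mul0r rmorph0 mul0r.
have piw : pi (w 0%N) = pi d ^+ l * pi x ^+ l.
  by rewrite /w subn0 rmorphM !rmorphXn pi_comm.
rewrite [pi (_ * _)]rmorphM piw /= !pi_cst uq [cst_at (_ * _)]rmorphM.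
rewrite mulrDr mulr1 addrC.
by rewrite [in RHS]mulrA.
Qed.

End RootOfUnity.
End PowerCommutation.

Lemma commrXX (R : pzRingType) (a b : R) k m :
  GRing.comm a b -> GRing.comm (a ^+ k) (b ^+ m).
Proof. by move=> ab; apply/commrX/commr_sym/commrX/commr_sym. Qed.

Section WeylAtRootOfUnity.
Variables (K : fieldType) (n : nat) (q : K) (l : nat) (A B : pzRingType).
Variables (pi : {rmorphism A -> B}) (cst : {rmorphism {poly K} -> A}).
Variables (cst_at : {rmorphism K -> B}) (x d : 'I_n -> A) (lam : K).
Hypothesis l_gt1 : (1 < l)%N.
Hypothesis q_prim : l.-primitive_root q.
Hypothesis cst_central : forall p a, GRing.comm (cst p) a.
Hypothesis xx : forall i j, GRing.comm (x i) (x j).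
Hypothesis dd : forall i j, GRing.comm (d i) (d j).
Hypothesis dx : forall i j,
  d i * x j = cst 'X ^+ (i == j) * (x j * d i) + (i == j)%:R.
Hypothesis pi_cst : forall p, pi (cst p) = cst_at p.[q].
Hypothesis pi_surj : forall b, exists a, pi a = b.
Hypothesis gen_B : forall y : B, (forall i, GRing.comm y (pi (x i))) ->
  (forall i, GRing.comm y (pi (d i))) -> forall b, GRing.comm y b.
Let tau := cst ('X - q%:P).
Hypothesis tau_regular : forall a, tau * a = 0 -> a = 0.
Hypothesis pi_ker : forall a, pi a = 0 -> exists b, a = tau * b.
Hypothesis lamE : lam * (qfall_quo q l).[q] = 1.

Notation y i := (pi (d i) ^+ l).
Notation z i := (pi (x i) ^+ l).

Let dx_eq i : d i * x i = cst 'X * (x i * d i) + 1.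
Proof. by rewrite dx eqxx expr1. Qed.

Let dx_neq i j : i != j -> GRing.comm (d i) (x j).
Proof. by move=> /negbTE ij; rewrite /GRing.comm dx ij expr0 mul1r addr0. Qed.

Lemma dl_central i b : GRing.comm (y i) b.
Proof.
apply: gen_B => j; last by apply/commr_sym/commrX; rewrite /GRing.comm -!rmorphM dd.
have [<-|ij] := eqVneq i j.
  exact: (pi_dl_x l_gt1 q_prim cst_central (dx_eq i) pi_cst).
by apply/commr_sym/commrX/commr_sym; rewrite /GRing.comm -!rmorphM dx_neq.
Qed.

Lemma xl_central i b : GRing.comm (z i) b.
Proof.
apply: gen_B => j; first by apply/commr_sym/commrX; rewrite /GRing.comm -!rmorphM xx.
have [->|ij] := eqVneq j i.
  exact/commr_sym/(pi_d_xl l_gt1 q_prim cst_central (dx_eq i) pi_cst).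
by apply/commr_sym/commrX; rewrite /GRing.comm -!rmorphM dx_neq.
Qed.

Lemma nform_qbracket f g : qbracket pi tau (cst_at lam)
  (nform cst_at (fun i => y i) (fun i => z i) f)
  (nform cst_at (fun i => y i) (fun i => z i) g)
  (nform cst_at (fun i => y i) (fun i => z i) (poisson_def (- (1 - q) ^+ l) f g)).
Proof.
have cst_at_lift e : exists2 a, pi a = cst_at e & forall b, GRing.comm a b.
  by exists (cst e%:P) => [|b]; [rewrite pi_cst hornerC | exact: cst_central].
have tau_central a : GRing.comm tau a by exact: cst_central.
have lam_central b : GRing.comm (cst_at lam) b.
  by have [a <- a_c] := cst_at_lift lam; have [b' <-] := pi_surj b;
    rewrite /GRing.comm -!rmorphM a_c.
have yc i b : y i * b = b * y i by exact: dl_central.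
have zc i b : z i * b = b * z i by exact: xl_central.
have comm_qbr a b : (forall e, pi a * e = e * pi a) ->
    (forall e, pi b * e = e * pi b) ->
    GRing.comm a b -> qbracket pi tau (cst_at lam) (pi a) (pi b) 0.
  by move=> ac bc ab; exact: qbracket_comm.
apply: nform_poisson => //.
- move=> i j; rewrite -!rmorphXn.
  by apply: comm_qbr; rewrite ?rmorphXn //; exact: commrXX.
- move=> i j; rewrite -!rmorphXn.
  by apply: comm_qbr; rewrite ?rmorphXn //; exact: commrXX.
move=> i j; have [<-|ij] := eqVneq i j; last first.
  rewrite mul0r -!rmorphXn; apply: comm_qbr; rewrite ?rmorphXn //.
  by apply: commrXX; exact: dx_neq.
(* In [pi C] the common factor, the value of [qfall_quo] at [q], is cancelled by [lam]. *)
have [C [EC piC]] := comm_dl_xl l_gt1 q_prim cst_central (dx_eq i) pi_cst.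
split=> //; exists (d i ^+ l), (x i ^+ l), C; split=> //.
- by rewrite rmorphXn.
- by rewrite rmorphXn.
- by rewrite piC [RHS]mulrA -rmorphM lamE rmorph1.
Qed.

End WeylAtRootOfUnity.

(** * The algebras [qweyl] and [qweyl_at] *)

Section QuotientRing.
Variables (A : pzRingType) (S : set A).

Lemma quot_map_eq0 a : quot_map S a = 0 <-> ideal_gen S a.
Proof.
rewrite -(rmorph0 (quot_map S)); split.
  move/eqP; rewrite /quot_map quot_piE subr0 => Ia; exact/in_ideal_genP.
move=> Ia; apply/eqP; rewrite /quot_map quot_piE subr0; exact/in_ideal_genP.
Qed.

Lemma quot_map_rel a : S a -> quot_map S a = 0.
Proof. by move=> Sa; apply/quot_map_eq0 => J [_]; apply. Qed.

Lemma quot_map_repr z : quot_map S (repr z) = z.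
Proof. exact: reprK. Qed.

Lemma quot_map_surj z : exists a, quot_map S a = z.
Proof. by exists (repr z); exact: quot_map_repr. Qed.

Lemma ideal_gen_repr a : ideal_gen S (repr (quot_map S a) - a).
Proof. by apply/quot_map_eq0; rewrite rmorphB /= quot_map_repr subrr. Qed.

End QuotientRing.

Lemma ideal_gen1 (A : pzRingType) (t a : A) : (forall b, GRing.comm t b) ->
  ideal_gen [set t]%classic a -> exists b, a = t * b.
Proof.
move=> t_central Ia; apply: (Ia (fun a => exists b, a = t * b)); split; last first.
  by move=> _ ->; exists 1; rewrite mulr1.
split=> [|_ _ [b ->] [c ->]|b _ [c ->]|b _ [c ->]].
- by exists 0; rewrite mulr0.
- by exists (b - c); rewrite mulrBr.
- by exists (b * c); rewrite mulrA -t_central mulrA.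
- by exists (c * b); rewrite mulrA.
Qed.

Lemma rmorph_comm_rel (A Q : pzRingType) (f : {rmorphism A -> Q}) a b :
  f (a * b - b * a) = 0 -> GRing.comm (f a) (f b).
Proof. by rewrite rmorphB !rmorphM => /eqP; rewrite subr_eq0 => /eqP. Qed.

Lemma rmorph_qcomm_rel (A Q : pzRingType) (f : {rmorphism A -> Q}) a b c k m :
  f (a * b - c ^+ k * (b * a) - m%:R) = 0 ->
  f a * f b = f c ^+ k * (f b * f a) + m%:R.
Proof.
rewrite !rmorphB !rmorphM rmorphXn rmorph_nat => /eqP.
by rewrite subr_eq0 subr_eq addrC => /eqP.
Qed.

(** * Laurent constants and the value of [lambda] *)

Section LaurentMorphisms.
Variable K : fieldType.

Lemma laurent_poly_zmod : zmod_morphism (@laurent_poly K).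
Proof. by move=> p r; apply: val_inj; rewrite raddfB /= tofracB. Qed.

Lemma laurent_poly_monoid : monoid_morphism (@laurent_poly K).
Proof.
by split=> [|p r]; apply: val_inj; rewrite ?rmorph1 ?rmorphM /= ?tofrac1 ?tofracM.
Qed.

HB.instance Definition _ :=
  GRing.isZmodMorphism.Build {poly K} (laurent K) (@laurent_poly K) laurent_poly_zmod.
HB.instance Definition _ :=
  GRing.isMonoidMorphism.Build {poly K} (laurent K) (@laurent_poly K)
    laurent_poly_monoid.

Lemma laurent_poly_lreg (p : {poly K}) : p != 0 -> GRing.lreg (laurent_poly p).
Proof.
move=> p0 f g /(congr1 val); rewrite !rmorphM /= => E; apply: val_inj.
by apply: mulfI E; rewrite tofrac_eq0.
Qed.

Lemma laurentP (f : laurent K) : exists p k, laurent_poly 'X^k * f = laurent_poly p.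
Proof.
have /is_laurentP[p [k E]] := laurent_valP f.
exists p, k; apply: val_inj; rewrite rmorphM /= E tofracXn mulrC divfK //.
by rewrite expf_neq0 // ratX_neq0.
Qed.

(** Clearing powers of [t] and evaluating at [q] gives [q ^+ k * c = 0]. *)
Lemma laurent_const_mulXB (q c : K) (f : laurent K) : q != 0 ->
  laurent_poly c%:P = laurent_poly ('X - q%:P) * f -> c = 0.
Proof.
move=> q0 E; have [p [k Ep]] := laurentP f.
have /(congr1 val)/= /eqP : laurent_poly ('X^k * c%:P) = laurent_poly (('X - q%:P) * p).
  by rewrite !rmorphM /= -Ep E mulrCA.
rewrite tofrac_eq => /eqP/(congr1 (horner^~ q)).
rewrite hornerM hornerXn hornerC hornerM hornerXsubC subrr mul0r => /eqP.
by rewrite mulf_eq0 expf_eq0 (negbTE q0) andbF => /eqP.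
Qed.

Lemma qint_poly (m : nat) : qint K m = FracField.tofrac (qnum K m).
Proof.
rewrite /qint -tofracXn -tofrac1 -!tofracB -[1 - 'X^m]opprB -qnumM1 -mulrN opprB.
rewrite tofracM.
by rewrite mulfK // tofrac_eq0 -oppr_eq0 opprB -polyC1 polyXsubC_eq0.
Qed.

Lemma qfact_poly (m : nat) : qfact K m = FracField.tofrac (qfall K m m).
Proof.
rewrite /qfact big_add1 big_mkord /qfall (reindex_inj rev_ord_inj) /=.
rewrite (big_morph (@FracField.tofrac _) (@tofracM _) (@tofrac1 _)).
by apply: eq_bigr => k _; rewrite subnSK // qint_poly.
Qed.

(** Two representations with denominators nonzero at [q] have equal cross products, so whatever
    [xget] chooses is this value. *)
Lemma rat_evalE (q : K) (p d : {poly K}) : d.[q] != 0 ->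
  rat_eval q (FracField.tofrac p / FracField.tofrac d) = p.[q] / d.[q].
Proof.
move=> dq; rewrite /rat_eval; case: xgetP => [v _ [p' [d' [dq' E ->]]]|].
  have nz (e : {poly K}) : e.[q] != 0 -> FracField.tofrac e != 0.
    by move=> eq0; rewrite tofrac_eq0; apply: contraNneq eq0 => ->; rewrite horner0.
  move/eqP: E; rewrite eqr_div ?nz // -!tofracM tofrac_eq => /eqP E.
  apply/eqP; rewrite eqr_div // -!hornerM -E //.
by move=> /(_ (p.[q] / d.[q])); case; exists p, d.
Qed.

(** The factor [t - q] cancels against the one split off from [[l]_t!], and the remaining
    denominator does not vanish at [q]. *)
Lemma lambdaE (q : K) (l : nat) : (1 < l)%N -> l.-primitive_root q -> l%:R != 0 :> K ->
  lambda l q * (qfall_quo q l).[q] = 1.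
Proof.
move=> l_gt1 q_prim l_neq0.
have G0 := qfall_quo_neq0 l_gt1 q_prim l_neq0.
have G0' : FracField.tofrac (qfall_quo q l) != 0.
  by rewrite tofrac_eq0; apply: contraNneq G0 => ->; rewrite horner0.
have XB0 : FracField.tofrac ('X - q%:P) != 0 by rewrite tofrac_eq0 polyXsubC_eq0.
rewrite /lambda qfact_poly (qfallll l_gt1 q_prim) tofracM invfM mulVKf // -[_^-1]mul1r.
by rewrite -tofrac1 rat_evalE // hornerC div1r mulVf.
Qed.

End LaurentMorphisms.

Lemma rmorphism_comp (C A Q : pzRingType) (f : {rmorphism A -> Q})
  (g : {rmorphism C -> A}) : monoid_morphism (fun c => f (g c)).
Proof. by split=> [|c e]; rewrite ?rmorph1 ?rmorphM. Qed.

Lemma comm_rmorph (A Q : pzRingType) (f : {rmorphism A -> Q}) a b :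
  GRing.comm a b -> GRing.comm (f a) (f b).
Proof. by rewrite /GRing.comm -!rmorphM => ->. Qed.

Section FreeAlgebra.
Variables (K : fieldType) (n : nat).
Notation L := (laurent K).
Notation FA := (free_alg K n).

Lemma free_const_zmod : zmod_morphism (@free_const K n).
Proof. exact: monalg.monalgU_is_additive. Qed.

Lemma free_const_monoid : monoid_morphism (@free_const K n).
Proof.
have [M1 M2] := @monalg.malgC_is_multiplicative
  (monalg.fmonom ('I_n + 'I_n)%type) L.
by split.
Qed.

HB.instance Definition _ :=
  GRing.isZmodMorphism.Build L FA (@free_const K n) free_const_zmod.
HB.instance Definition _ :=
  GRing.isMonoidMorphism.Build L FA (@free_const K n) free_const_monoid.

Lemma free_mulU (v w : monalg.fmonom ('I_n + 'I_n)%type) (c e : L) :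
  monalg.mkmalgU v c * monalg.mkmalgU w e
    = monalg.mkmalgU (monalg.fmmul v w) (c * e) :> FA.
Proof. exact: monalg.fgmulUU. Qed.

Lemma free_const_comm_gen c g :
  GRing.comm (free_const n c) (free_gen K g).
Proof.
rewrite /GRing.comm /free_const /free_gen !free_mulU.
by rewrite monalg.fmmul1m monalg.fmmulm1 mul1r mulr1.
Qed.

Lemma free_word (c : L) (w : seq ('I_n + 'I_n)) :
  monalg.mkmalgU (monalg.FMonom w) c
    = free_const n c * foldr (fun g a => free_gen K g * a) 1 w :> FA.
Proof.
have E (v : seq ('I_n + 'I_n)) :
    foldr (fun g a => free_gen K g * a) 1 v = monalg.mkmalgU (monalg.FMonom v) 1 :> FA.
  elim: v => [|g v IH] /=; first by rewrite -monalg.fmoneE.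
  by rewrite IH /free_gen free_mulU mul1r monalg.fmmulE monalg.fmuE.
by rewrite E /free_const free_mulU mulr1 monalg.fmmul1m.
Qed.

Lemma free_algE (a : FA) : a = \sum_(w <- monalg.msupp a)
  monalg.mkmalgU w (monalg.mcoeff w a).
Proof. exact: monalg.monalgE. Qed.

End FreeAlgebra.

Lemma generated_ind (C A Q : pzRingType) (I : Type) (f : {rmorphism A -> Q})
    (cst : {rmorphism C -> A}) (gen : I -> A) (P : Q -> Prop) :
  (forall a : A, exists (r : seq (C * seq I)),
     a = \sum_(w <- r) cst w.1 * foldr (fun g b => gen g * b) 1 w.2) ->
  P 1 -> (forall a b, P a -> P b -> P (a + b)) ->
  (forall c a, P a -> P (f (cst c) * a)) -> (forall g a, P a -> P (f (gen g) * a)) ->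
  forall a, P (f a).
Proof.
move=> A_gen P1 PD PC PG a; have [r ->] := A_gen a.
(* The empty sum is reached by multiplying [1] by the scalar zero. *)
have P0 : P 0 by have := PC 0 1 P1; rewrite !rmorph0 mul0r.
rewrite rmorph_sum; apply: big_ind => //= -[c w] _; rewrite rmorphM /=; apply: PC.
elim: w => [|g w IH] /=; first by rewrite rmorph1.
by rewrite rmorphM; apply: PG.
Qed.

Section QWeyl.
Variables (K : fieldType) (n : nat).
Notation L := (laurent K).
Notation FA := (free_alg K n).
Notation W := (qweyl K n).
Notation qm := (quot_map (weyl_relations (K := K) (n := n))).

Lemma qweyl_const_zmod : zmod_morphism (@qweyl_const K n : L -> W).
Proof. by move=> c e; rewrite /qweyl_const !raddfB. Qed.

Lemma qweyl_const_monoid : monoid_morphism (@qweyl_const K n : L -> W).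
Proof. exact: (rmorphism_comp qm (@free_const K n)). Qed.

HB.instance Definition _ :=
  GRing.isZmodMorphism.Build L W (@qweyl_const K n) qweyl_const_zmod.
HB.instance Definition _ :=
  GRing.isMonoidMorphism.Build L W (@qweyl_const K n) qweyl_const_monoid.

Lemma qweyl_ind (P : W -> Prop) : P 1 -> (forall a b, P a -> P b -> P (a + b)) ->
  (forall c a, P a -> P (qweyl_const n c * a)) ->
  (forall i a, P a -> P (qweyl_x K i * a)) ->
  (forall i a, P a -> P (qweyl_d K i * a)) -> forall a, P a.
Proof.
move=> P1 PD PC Px Pd a; have [b <-] := quot_map_surj a.
apply: (@generated_ind L FA W _ qm (@free_const K n) (@free_gen K n) P)
  => // [{}b|[i|i]].
- exists [seq (monalg.mcoeff w b, monalg.fmonom_val w) | w <- monalg.msupp b].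
  rewrite big_map [LHS]free_algE; apply: eq_bigr => -[w] _ /=; exact: free_word.
- exact: Px.
- exact: Pd.
Qed.

Lemma qweyl_const_central c (a : W) : GRing.comm (qweyl_const n c) a.
Proof.
have comm_gen g : GRing.comm (qweyl_const n c : W) (qm (free_gen K g)).
  exact: (comm_rmorph qm (free_const_comm_gen _ _)).
elim/qweyl_ind: a => [|a b|e a|i a|i a]; first exact: commr1.
- exact: commrD.
- apply: commrM; exact: (comm_rmorph (@qweyl_const K n) (mulrC _ _)).
- by apply: commrM; exact: comm_gen.
- by apply: commrM; exact: comm_gen.
Qed.

Lemma qweyl_xx i j : GRing.comm (qweyl_x K i : W) (qweyl_x K j).
Proof.
apply: (rmorph_comm_rel (f := qm)); apply: quot_map_rel.
by exists i, j; apply: Or32.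
Qed.

Lemma qweyl_dd i j : GRing.comm (qweyl_d K i : W) (qweyl_d K j).
Proof.
apply: (rmorph_comm_rel (f := qm)); apply: quot_map_rel.
by exists i, j; apply: Or33.
Qed.

Lemma qweyl_dx i j : (qweyl_d K i : W) * qweyl_x K j
  = qweyl_const n (laurent_poly 'X) ^+ (i == j) * (qweyl_x K j * qweyl_d K i)
    + (i == j)%:R.
Proof.
apply: (rmorph_qcomm_rel (f := qm)); apply: quot_map_rel.
by exists i, j; apply: Or31.
Qed.

Definition qweyl_act (a : W) := act (repr a).

(** The chosen representative differs from [a] by an element of the ideal, which acts as zero. *)
Lemma qweyl_actE a : qweyl_act (qm a) =1 act a.
Proof.
move=> u; apply/funext => m; apply/eqP; rewrite -subr_eq0 -actB; apply/eqP.
by rewrite act_ideal //; exact: ideal_gen_repr.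
Qed.

Lemma qweyl_actD (a b : W) u m :
  qweyl_act (a + b) u m = qweyl_act a u m + qweyl_act b u m.
Proof.
have [a' <-] := quot_map_surj a; have [b' <-] := quot_map_surj b.
by rewrite -rmorphD !qweyl_actE; exact: raddfD.
Qed.

Lemma qweyl_actM (a b : W) u : qweyl_act (a * b) u = qweyl_act a (qweyl_act b u).
Proof.
have [a' <-] := quot_map_surj a; have [b' <-] := quot_map_surj b.
by rewrite -rmorphM !qweyl_actE; exact: actM.
Qed.

Lemma qweyl_act_const c u m : qweyl_act (qweyl_const n c) u m = c * u m.
Proof. by rewrite qweyl_actE act_const. Qed.

Lemma qweyl_act_gen g : qweyl_act (qm (free_gen K g)) =1 gen_act g.
Proof. by move=> u; rewrite qweyl_actE act_gen. Qed.

Notation nf := (nform (@qweyl_const K n) (@qweyl_x K n) (@qweyl_d K n)).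

Lemma qweyl_nform_surj (a : W) : exists f, a = nf f.
Proof.
exact: (nform_surj qweyl_const_central qweyl_xx qweyl_dd qweyl_dx qweyl_ind).
Qed.

Lemma qweyl_nform_eq0 f : nf f = 0 -> f = 0.
Proof.
exact: (nform_eq0 qweyl_xx qweyl_dd qweyl_actD qweyl_actM qweyl_act_const
  (fun i => qweyl_act_gen (inl i)) (fun i => qweyl_act_gen (inr i))).
Qed.

Lemma qweyl_const_regular (c : L) : GRing.lreg c ->
  forall a : W, qweyl_const n c * a = 0 -> a = 0.
Proof.
exact: (cst_regular qweyl_const_central qweyl_xx qweyl_dd qweyl_dx qweyl_ind
  qweyl_actD qweyl_actM qweyl_act_const
  (fun i => qweyl_act_gen (inl i)) (fun i => qweyl_act_gen (inr i))).
Qed.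

End QWeyl.

Lemma comp_zmod_morphism (C A Q : zmodType) (f : {additive A -> Q})
  (g : {additive C -> A}) : zmod_morphism (fun c => f (g c)).
Proof. by move=> c e; rewrite !raddfB. Qed.

Lemma comm_ind (W Q : pzRingType) (f : {rmorphism W -> Q}) (C I : Type) (cst : C -> W)
    (x d : I -> W) (y : Q) :
  (forall P : W -> Prop, P 1 -> (forall a b, P a -> P b -> P (a + b)) ->
    (forall c a, P a -> P (cst c * a)) -> (forall i a, P a -> P (x i * a)) ->
    (forall i a, P a -> P (d i * a)) -> forall a, P a) ->
  (forall b, exists a, f a = b) ->
  (forall c a, GRing.comm (cst c) a) ->
  (exists y', f y' = y) ->
  (forall i, GRing.comm y (f (x i))) -> (forall i, GRing.comm y (f (d i))) ->
  forall b, GRing.comm y b.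
Proof.
move=> W_ind f_surj cst_c [y' Ey] yx yd b; have [a <-] := f_surj b.
elim/W_ind: a => [|a a' Ha Ha'|c a Ha|i a Ha|i a Ha].
- by rewrite rmorph1; exact: commr1.
- by rewrite rmorphD; exact: commrD.
- rewrite rmorphM; apply: commrM => //; rewrite -Ey.
  by rewrite /GRing.comm -!rmorphM cst_c.
- by rewrite rmorphM; exact: commrM.
- by rewrite rmorphM; exact: commrM.
Qed.

Lemma rmorph_eval (K : fieldType) (W Q : pzRingType) (f : {rmorphism W -> Q})
    (cst : {rmorphism {poly K} -> W}) (q : K) p :
  f (cst ('X - q%:P)) = 0 -> f (cst p) = f (cst p.[q]%:P).
Proof.
move=> fq; apply/eqP; rewrite -subr_eq0 -!rmorphB; apply/eqP.
have /factor_theorem[r ->] : root (p - p.[q]%:P) q by rewrite rootE !hornerE subrr.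
by rewrite !rmorphM fq mulr0.
Qed.

(** * The map [Theta]: lifts, injectivity and the transported bracket *)

Section Frobenius.
Variables (n l : nat).
Notation mon := (multinom (n + n)).

(** The exponent of the ordered monomial in [x] and [d] corresponding under
    [Theta] to the monomial of [O_{2n}] of exponent [m] *)
Definition theta_exp (m : mon) : mon :=
  Multinom [tuple match fintype.split i with
                  | inl j => m (rshift n j) * l
                  | inr j => m (lshift n j) * l
                  end%N | i < n + n].

Lemma theta_exp_l m j : theta_exp m (lshift n j) = (m (rshift n j) * l)%N.
Proof. by rewrite mnmE (unsplitK (inl j)). Qed.

Lemma theta_exp_r m j : theta_exp m (rshift n j) = (m (lshift n j) * l)%N.
Proof. by rewrite mnmE (unsplitK (inr j)). Qed.

Lemma theta_exp_inj : (0 < l)%N -> injective theta_exp.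
Proof.
move=> l0 m m' E; apply/mnmP => i; apply/eqP; rewrite -(eqn_pmul2r l0); apply/eqP.
case: (split_ordP i) => j ->.
  by rewrite -!theta_exp_r E.
by rewrite -!theta_exp_l E.
Qed.

(** Ordered monomials put [x] first while [Theta] puts the powers of [d] first; centrality of
    [d_i ^+ l] in the quotient allows the exchange. *)
Lemma omon_theta_exp (A Q : pzRingType) (f : {rmorphism A -> Q}) (x d : 'I_n -> A) m :
  (forall i b, GRing.comm (f (d i) ^+ l) b) ->
  f (omon x d (theta_exp m))
    = omon (fun i => f (d i) ^+ l) (fun i => f (x i) ^+ l) m.
Proof.
move=> dlc; rewrite /omon rmorphM !rmorph_prod /=.
rewrite (eq_bigr (fun i => (f (x i) ^+ l) ^+ m (rshift n i))); last first.
  by move=> i _; rewrite rmorphXn theta_exp_l mulnC exprM.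
rewrite [X in _ * X](eq_bigr (fun i => (f (d i) ^+ l) ^+ m (lshift n i))); last first.
  by move=> i _; rewrite rmorphXn theta_exp_r mulnC exprM.
by apply: commr_prod => i _; apply: commrX; exact/commr_sym/dlc.
Qed.

End Frobenius.

Section QWeylAt.
Variables (K : fieldType) (n : nat) (q : K).
Notation L := (laurent K).
Notation W := (qweyl K n).
Notation Wq := (qweyl_at n q).
Notation tq := (t_minus_q n q).
Notation pm := (quot_map [set tq]%classic).
Notation cp := (@qweyl_const K n \o @laurent_poly K).

Lemma at_const_zmod : zmod_morphism (@at_const K n q : K -> Wq).
Proof. exact: (comp_zmod_morphism pm (cp \o polyC)). Qed.

Lemma at_const_monoid : monoid_morphism (@at_const K n q : K -> Wq).
Proof. exact: (rmorphism_comp pm (cp \o polyC)). Qed.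

HB.instance Definition _ :=
  GRing.isZmodMorphism.Build K Wq (@at_const K n q) at_const_zmod.
HB.instance Definition _ :=
  GRing.isMonoidMorphism.Build K Wq (@at_const K n q) at_const_monoid.

Lemma pi_t_minus_q : pm tq = 0.
Proof. exact: quot_map_rel. Qed.

Lemma pi_q_ker (a : W) : pm a = 0 -> exists b, a = tq * b.
Proof.
move/quot_map_eq0; apply: ideal_gen1; exact: qweyl_const_central.
Qed.

Lemma t_minus_q_regular (a : W) : tq * a = 0 -> a = 0.
Proof.
apply: qweyl_const_regular; apply: laurent_poly_lreg; by rewrite polyXsubC_eq0.
Qed.

Lemma pi_q_const p : pm (cp p) = at_const n q p.[q].
Proof. exact: (rmorph_eval (f := pm) (cst := cp) p pi_t_minus_q). Qed.

Lemma qweyl_at_comm (y : Wq) : (forall i, GRing.comm y (at_x q i)) ->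
  (forall i, GRing.comm y (at_d q i)) -> forall b, GRing.comm y b.
Proof.
apply: (comm_ind (f := pm) (@qweyl_ind K n) _ (@qweyl_const_central K n)).
- exact: quot_map_surj.
- exact: quot_map_surj.
Qed.

Variable l : nat.
Hypothesis l_gt1 : (1 < l)%N.
Hypothesis q_prim : l.-primitive_root q.
Hypothesis l_neq0 : l%:R != 0 :> K.

Notation nfq := (nform (@at_const K n q)
  (fun i => at_d q i ^+ l) (fun i => at_x q i ^+ l)).

Lemma ThetaE (f : mpoly (n + n) K) : Theta q l f = nfq f.
Proof. by apply: eq_bigr => m _; rewrite -mulrA. Qed.

Lemma Theta_qbracket (f g : mpoly (n + n) K) :
  is_poisson_q l (Theta q l f) (Theta q l g)
  (Theta q l (poisson_def (- (1 - q) ^+ l) f g)).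
Proof.
rewrite !ThetaE.
have cpc p a : GRing.comm (cp p) a by exact: qweyl_const_central.
exact: (nform_qbracket (pi := pm) (cst := cp) (cst_at := @at_const K n q)
  l_gt1 q_prim cpc (@qweyl_xx K n) (@qweyl_dd K n) (@qweyl_dx K n) pi_q_const
  (@quot_map_surj _ _) qweyl_at_comm pi_q_ker (lambdaE l_gt1 q_prim l_neq0)).
Qed.

Let at_d_central (i : 'I_n) (b : Wq) : GRing.comm (at_d q i ^+ l) b.
Proof.
exact: (dl_central (pi := pm) (cst := cp) (cst_at := @at_const K n q) l_gt1 q_prim
  (fun p a => qweyl_const_central (laurent_poly p) a) (@qweyl_dd K n) (@qweyl_dx K n)
  pi_q_const qweyl_at_comm).
Qed.

Notation lconst := (@mpolyC (n + n) L \o @laurent_poly K \o polyC).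

(** The normal form over [K[t, t^-1]] of a lift of [Theta f] *)
Definition theta_lift (f : mpoly (n + n) K) : mpoly (n + n) L :=
  lin_ext (fun m => scaled_morph lconst (mpolyX L (theta_exp l m))) f.

Lemma theta_liftD f g : theta_lift (f + g) = theta_lift f + theta_lift g.
Proof. exact: raddfD. Qed.

Lemma theta_liftZX c m : theta_lift (c *: mpolyX K m) =
  laurent_poly c%:P *: mpolyX L (theta_exp l m).
Proof. by rewrite /theta_lift lin_extZX; exact: mul_mpolyC. Qed.

Lemma theta_lift0 : theta_lift 0 = 0.
Proof. exact: raddf0. Qed.

Notation nf := (nform (@qweyl_const K n) (@qweyl_x K n) (@qweyl_d K n)).

Lemma pi_theta_lift f : pm (nf (theta_lift f)) = nfq f.
Proof.
elim/mpolyind: f => [|c m f _ _ IH]; first by rewrite theta_lift0 !raddf0.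
rewrite theta_liftD theta_liftZX.
transitivity (pm (nf (laurent_poly c%:P *: mpolyX L (theta_exp l m)))
    + pm (nf (theta_lift f))); first by rewrite !raddfD.
rewrite [RHS]raddfD; congr (_ + _); last exact: IH.
rewrite [RHS]nformZX -(omon_theta_exp (f := pm) (@qweyl_x K n)) //.
exact: etrans (congr1 pm (nformZX _ _ _ _ _)) (rmorphM pm _ _).
Qed.

Lemma mcoeff_theta_lift f m :
  mcoeff (theta_exp l m) (theta_lift f) = laurent_poly (mcoeff m f)%:P.
Proof.
elim/mpolyind: f => [|c k f _ _ IH].
  by rewrite theta_lift0 !mcoeff0 polyC0 raddf0.
rewrite theta_liftD theta_liftZX !mcoeffD IH !mcoeffZ !mcoeffX polyCD raddfD.
congr (_ + _).
rewrite (inj_eq (theta_exp_inj (ltnW l_gt1))).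
by case: eqP => _; rewrite ?mulr1 // !mulr0 polyC0 raddf0.
Qed.

(** The lift of an element of the kernel is [t - q] times a normal form. By PBW the comparison is
    coefficientwise, so each constant coefficient is divisible by [t - q] and hence zero. *)
Lemma Theta_inj : injective (@Theta K n q l).
Proof.
move=> f g; rewrite !ThetaE => /eqP; rewrite -subr_eq0 -raddfB => /eqP E.
apply/eqP; rewrite -subr_eq0; apply/eqP; move: E; set h := f - g => h0.
have [b] := pi_q_ker (etrans (pi_theta_lift h) h0).
have [e ->] := qweyl_nform_surj b.
rewrite -nformZ => /eqP; rewrite -subr_eq0 -raddfB => /eqP /qweyl_nform_eq0.
move/eqP; rewrite subr_eq0 => /eqP E.
apply/mpolyP => m; rewrite mcoeff0.
apply: (@laurent_const_mulXB _ q _ (mcoeff (theta_exp l m) e)).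
  apply: contraTneq l_gt1 => q0; have := prim_expr_order q_prim.
  by rewrite q0 expr0n; case: l => // k /eqP; rewrite /= eq_sym oner_eq0.
by rewrite -mcoeff_theta_lift E mcoeffZ.
Qed.

Lemma poisson_q_ThetaE (f g : mpoly (n + n) K) :
  Theta_inv l (poisson_q l (Theta q l f) (Theta q l g))
  = poisson_def (- (1 - q) ^+ l) f g.
Proof.
have HV := Theta_qbracket f g.
have -> : poisson_q l (Theta q l f) (Theta q l g) =
    Theta q l (poisson_def (- (1 - q) ^+ l) f g).
  (* The choice made by [xget] exists by [HV] and is pinned down by uniqueness of the bracket;
     [Theta_inj] does the same for [Theta_inv] below. *)
  rewrite /poisson_q; case: xgetP => [V _ HV'|]; last by move/(_ _ HV).
  exact: (@qbracket_unique _ _ pm tq (at_const n q (lambda l q))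
    (@qweyl_const_central K n _) t_minus_q_regular pi_q_ker _ _ _ _ HV' HV).
rewrite /Theta_inv; case: xgetP => [h _ Hh|]; first exact: Theta_inj.
by move=> /(_ (poisson_def (- (1 - q) ^+ l) f g)) /(_ erefl).
Qed.

End QWeylAt.

(** * The limit *)

Section Limit.
Variable R : realType.

(** De Moivre, from the addition formulas. *)
Lemma q_rootX (l k : nat) : q_root R l ^+ k =
  cos (2 * pi / l%:R *+ k) +i* sin (2 * pi / l%:R *+ k).
Proof.
elim: k => [|k IH]; first by rewrite expr0 mulr0n cos0 sin0.
rewrite exprS IH [_ *+ k.+1]mulrS cosD sinD /q_root; simpc.
by congr (_ +i* _); rewrite addrC.
Qed.

(** If the order [m] were below [l], then [cos (2 pi m / l) = 1], and the double angle formula would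
    force [sin (pi m / l) = 0] although [0 < pi m / l < pi]. *)
Lemma q_root_prim (l : nat) : (1 < l)%N -> l.-primitive_root (q_root R l).
Proof.
move=> l_gt1; have l_gt0 : (0 < l)%N by exact: ltnW.
have l0 : l%:R != 0 :> R by rewrite pnatr_eq0 -lt0n.
have ql : q_root R l ^+ l = 1.
  rewrite q_rootX -[_ *+ l]mulr_natr divfK // mulr_natl.
  by rewrite cos2pi sin2pi.
have [m m_prim m_dvd] := prim_order_exists l_gt0 ql.
suff E : m = l by move: m_prim; rewrite E.
apply/eqP; rewrite eqn_leq (dvdn_leq l_gt0 m_dvd) leqNgt.
apply/negP => lt_ml.
have m_gt0 := prim_order_gt0 m_prim.
have cos1 : cos (2 * pi / l%:R *+ m) = 1 :> R.
  by have := congr1 (@complex.Re R) (prim_expr_order m_prim); rewrite q_rootX.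
have E : 2 * pi / l%:R *+ m = (pi * (m%:R / l%:R)) *+ 2 :> R.
  by rewrite -[LHS]mulr_natr -[RHS]mulr_natr; field.
move: cos1; rewrite E cos_mulr2n => E2.
have := cos2Dsin2 (pi * (m%:R / l%:R) : R).
have s0 : 0 < sin (pi * (m%:R / l%:R) : R).
  have ml0 : 0 < m%:R / l%:R :> R by apply: divr_gt0; rewrite ltr0n.
  apply: sin_gt0_pi; apply/andP; split; first exact: mulr_gt0 (pi_gt0 R) ml0.
  rewrite -[X in _ < X]mulr1 ltr_pM2l ?pi_gt0 // ltr_pdivrMr ?ltr0n //.
  by rewrite mul1r ltr_nat.
move=> E1.
have : sin (pi * (m%:R / l%:R) : R) ^+ 2 != 0 by rewrite expf_neq0 // gt_eqF.
move/eqP; apply; rewrite mulr2n in E2; lra.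
Qed.

Lemma cvg_root_angle : (2 * pi / l%:R : R) @[l --> \oo] --> (0 : R).
Proof.
have inv0 : (l%:R^-1 : R) @[l --> \oo] --> (0 : R).
  (* The harmonic sequence is indexed as [1 / (l + 1)], hence the shift. *)
  by rewrite -cvg_shiftS; exact: cvg_harmonic.
have H := cvgM (cvg_cst (2 * pi : R)) inv0.
rewrite mulr0 in H.
exact: H.
Qed.

(** The square of the modulus is [2 - 2 cos], below [1/4] once the cosine exceeds [7/8]. Any
    constant bound below [1] would serve, as [1 - q] enters through its [l]-th power. *)
Lemma norm_1Bq_root : \forall l \near \oo, `|1 - q_root R l| <= 2^-1.
Proof.
have : (cos (2 * pi / l%:R) : R) @[l --> \oo] --> (1 : R).
  have H := cvg_comp _ _ cvg_root_angle (@continuous_cos R 0).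
  by rewrite cos0 in H; exact: H.
move/cvgrPdist_lt/(_ 8^-1); rewrite invr_gt0 ltr0n => /(_ isT).
apply: filterS => l; rewrite ltr_norml => /andP[_ cosl].
rewrite -ler_sqr ?nnegrE ?invr_ge0 ?ler0n // -add_Re2_Im2.
have -> : (2^-1 ^+ 2 : R[i]) = (4^-1 : R)%:C.
  by rewrite fmorphV rmorph_nat exprVn -natrX.
rewrite lecR /q_root /=.
have := cos2Dsin2 (2 * pi / l%:R : R).
move: cosl; set c := cos _; set s := sin _ => cosl E.
rewrite (_ : _ + _ = 2 - 2 * c) ?sub0r; lra.
Qed.

Lemma near_exp_half (e B : R) : 0 < e -> 0 <= B ->
  \forall l \near \oo, 2^-1 ^+ l * B < e.
Proof.
(* Dividing by [B + 1] rather than [B] covers [B = 0]. *)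
move=> e0 B0; have B1 : 0 < B + 1 by rewrite ltr_wpDl.
have half1 : `|2^-1 : R| < 1.
  by rewrite ger0_norm ?invr_ge0 ?ler0n // invf_lt1 ?ltr0n // ltr1n.
have /cvgr0_norm_lt/(_ _ (divr_gt0 e0 B1)) := @cvg_expr R _ half1.
apply: filterS => l; rewrite ger0_norm ?exprn_ge0 ?invr_ge0 ?ler0n //.
rewrite ltr_pdivlMr //; apply: le_lt_trans.
by rewrite ler_wpM2l ?exprn_ge0 ?invr_ge0 ?ler0n // lerDl.
Qed.

Lemma cvg_deformation (a b : R[i]) :
  ((a + (- (1 - q_root R l) ^+ l) * b) : (R[i] : numFieldType)) @[l --> \oo] -->
    (a : (R[i] : numFieldType)).
Proof.
apply/cvgrPdist_lt => e e0.
(* A positive element of [R[i]] has zero imaginary part, so the estimate can be made in [R]. *)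
have [e' Ee] : exists e' : R, e = e'%:C.
  exists (complex.Re e); move: e0.
  by case: e => x y; rewrite ltcE /= => /andP[/eqP -> _].
have [B EB] : exists B : R, `|b| = B%:C by rewrite normc_def; eexists.
have B0 : 0 <= B by rewrite -lecR -EB normr_ge0.
move: e0; rewrite Ee ltcR => e0.
near=> l.
rewrite opprD addNKr normrN normrM normrN normrX EB.
apply: (@le_lt_trans _ _ ((2^-1 ^+ l * B)%:C)).
  rewrite rmorphM ler_wpM2r ?lecR // rmorphXn fmorphV rmorph_nat.
  rewrite lerXn2r ?nnegrE ?invr_ge0 ?ler0n //.
  by near: l; exact: norm_1Bq_root.
by rewrite ltcR; near: l; exact: near_exp_half.
Unshelve. all: by end_near. Qed.

End Limit.

Lemma poisson_lE (R : realType) (n l : nat) (P Q : mpoly (n + n) R[i]) : (1 < l)%N ->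
  poisson_l l P Q = poisson_def (- (1 - q_root R l) ^+ l) P Q.
Proof.
move=> l_gt1; apply: poisson_q_ThetaE => //; first exact: q_root_prim.
by rewrite pnatr_eq0 -lt0n ltnW.
Qed.

Theorem proposition4p2 (R : realType) (n : nat) (hn : (1 <= n)%N)
    (P Q : mpoly (n + n) R[i]) :
  mpoly_cvg (fun l : nat => poisson_l l P Q) (poisson_std P Q).
Proof.
move=> m; set h := \sum_(i < n)
  (mpolyX R[i] (mnm1 (lshift n i)) * mpolyX R[i] (mnm1 (rshift n i)))
  * (mderiv (lshift n i) P * mderiv (rshift n i) Q
     - mderiv (lshift n i) Q * mderiv (rshift n i) P).
have H := @cvg_deformation R (mcoeff m (poisson_std P Q)) (mcoeff m h).
apply: cvg_trans H.
(* The closed formula for the bracket requires [1 < l], which holds eventually. *)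
apply: near_eq_cvg; near=> l.
rewrite poisson_lE ?poisson_defE ?mcoeffD ?mcoeffZ //.
by near: l; exact: nbhs_infty_gt.
Unshelve. all: by end_near. Qed.
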